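(* Let $\boldsymbol X$ be a random vector on $[0,\infty)^d$ with $F\in\mathcal{RV}(1/\gamma)$, $\gamma\in(0,1)$, satisfying the density assumptions and Condition 1 below. Then for each $j\in\{1,\dots,d\}$ there is a constant $c_j\in\mathbb R$ such that, with $\tau=1-1/t$, $$A_{X_j}\big(U_{X_j}(t)\big)^{-1}\left(\frac{\theta_j(\tau)}{Q_R(\tau)\,\overline w_j/(1-\gamma)}-1\right)\to c_j,\qquad t\to\infty.$$
   Context: Notation: $R=X_1+\dots+X_d$, $\mathcal S=\{\boldsymbol w\in[0,\infty)^d:\|\boldsymbol w\|_1=1\}$, $\boldsymbol W=R^{-1}\boldsymbol X$; for a random variable $Y$ with distribution $F_Y$, $U_Y(t)=\inf\{x:F_Y(x)\ge1-1/t\}$, $Q_Y(\tau)=U_Y(1/(1-\tau))$; $\theta_j(\tau)=\mathbb E(X_j\mid R>Q_R(\tau))$. $F\in\mathcal{RV}(1/\gamma)$ means $\mathbb P(R>x)$ is regularly varying with index $-1/\gamma$ and $\mathbb P(\boldsymbol W\in\cdot\mid R>t)\to H$ weakly on $\mathcal S$ as $t\to\infty$ for a probability measure $H$ (angular measure); $\overline w_j=\int_{\mathcal S}w_j\,H(\mathrm d\boldsymbol w)$. Density assumptions: $F$ has a density $f$ and $H$ has a bounded continuous density $h:\mathcal S\to(0,\infty)$ with $\lim_{t\to\infty}\sup_{\boldsymbol w\in\mathcal S}\big|t^d f(t\boldsymbol w)/\mathbb P(R>t)-h(\boldsymbol w)/\gamma\big|=0$. For $\boldsymbol x\in(0,\infty)^d$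 write $r=\|\boldsymbol x\|_1$, $\boldsymbol w=\boldsymbol x/r$. Condition 1: for some $\rho<0$ and every $j\in\{1,\dots,d\}$: (a) there is a function $A_{X_j}$ with $\lim_{t\to\infty}t^{-\rho}A_{X_j}(t)\in\mathbb R\setminus\{0\}$ and, for all $x>0$, $$\lim_{t\to\infty}\frac{\frac{1-F_{X_j}(tx)}{1-F_{X_j}(t)}-x^{-1/\gamma}}{A_{X_j}(t)}=x^{-1/\gamma}\frac{x^\rho-1}{\rho};$$ (b) there is a nonnull function $\lambda_j$, integrable on sets bounded away from zero, with $\sup_{\boldsymbol w\in\mathcal S}|\lambda_j(\boldsymbol w)|<\infty$, and a function $q_j(\boldsymbol x)\propto r^{-d-1/\gamma}h(\boldsymbol w)$, such that $$\lim_{t\to\infty}\frac{\frac{t^df(t\boldsymbol x)}{\mathbb P(X_j>t)}-q_j(\boldsymbol x)}{A_{X_j}(t)}=\lambda_j(\boldsymbol x)\quad\forall\boldsymbol x\in(0,\infty)^d,$$ and $\lim_{t\to\infty}\sup_{\boldsymbol w\in\mathcal S}\Big|\frac{t^df(t\boldsymbol w)/\mathbb P(X_j>t)-q_j(\boldsymbol w)}{A_{X_j}(t)}-\lambda_j(\boldsymbol w)\Big|=0$. *)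

(* Defs.v *)
(* R : realType, random vector X : T -> d.-tuple R
   on an abstract probability space; d.-tuple R carries the product sigma-algebra. *)
From HB Require Import structures.
From mathcomp Require Import all_boot all_order all_algebra.
From mathcomp Require Import all_classical all_reals all_analysis.
Set Implicit Arguments. Unset Strict Implicit. Unset Printing Implicit Defensive.
Import Order.TTheory GRing.Theory Num.Theory.
Import numFieldNormedType.Exports.
Local Open Scope classical_set_scope.
Local Open Scope ring_scope.

Section defs.
Variable R : realType.

Definition l1 (d : nat) (x : d.-tuple R) : R := \sum_(i < d) tnth x i.

Definition simplex (d : nat) : set (d.-tuple R) :=
  [set w | (forall i, 0 <= tnth w i) /\ l1 w = 1].

Definition orthant (d : nat) : set (d.-tuple R) :=
  [set x | forall i, 0 < tnth x i].

Definition orthant0 (d : nat) : set (d.-tuple R) :=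
  [set x | (forall i, 0 <= tnth x i) /\ 0 < l1 x].

Definition tscale (d : nat) (c : R) (x : d.-tuple R) : d.-tuple R :=
  map_tuple (fun y => c * y) x.

(* d-dimensional Lebesgue integral (of a nonnegative function), iterated *)
Fixpoint lebint (n : nat) : (n.-tuple R -> \bar R) -> \bar R :=
  match n with
  | 0 => fun g => g [tuple]
  | m.+1 => fun g =>
      (\int[@lebesgue_measure R]_x lebint (fun t : m.-tuple R => g (cons_tuple x t)))%E
  end.

Definition simplex_lift (d : nat) (v : (d.-1).-tuple R) : d.-tuple R :=
  [tuple (if (i < d.-1)%N then nth 0 v i else 1 - \sum_(y <- v) y) | i < d].

Definition simplex_dom (d : nat) : set ((d.-1).-tuple R) :=
  [set v | (forall i, 0 <= tnth v i) /\ \sum_(y <- v) y <= 1].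

(* integral over S w.r.t. (d-1)-dimensional Lebesgue measure of the
   first d-1 coordinates *)
Definition simplex_int (d : nat) (g : d.-tuple R -> \bar R) : \bar R :=
  lebint (fun v : (d.-1).-tuple R =>
            ((\1_(@simplex_dom d) v)%:E * g (simplex_lift v))%E).

Definition cont_on (d : nat) (A : set (d.-tuple R)) (g : d.-tuple R -> R) :=
  forall w, A w -> forall e : R, 0 < e -> exists2 del : R, 0 < del &
    forall v, A v -> (forall i, `|tnth v i - tnth w i| < del) -> `|g v - g w| < e.

Definition bounded_on (d : nat) (A : set (d.-tuple R)) (g : d.-tuple R -> R) :=
  exists M : R, forall w, A w -> `|g w| <= M.

Section prob.
Context {dT : measure_display} {T : measurableType dT} (P : probability T R).

Definition surv (Y : T -> R) (x : R) : R := fine (P [set w | x < Y w]).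
Definition cdf (Y : T -> R) (x : R) : R := fine (P [set w | Y w <= x]).
Definition Ufun (Y : T -> R) (t : R) : R := inf [set x | 1 - t^-1 <= cdf Y x].
Definition Qfun (Y : T -> R) (tau : R) : R := Ufun Y (1 - tau)^-1.
Definition cond_mean (Y : T -> R) (A : set T) : R :=
  fine (\int[P]_(w in A) (Y w)%:E)%E / fine (P A).

End prob.
End defs.
Arguments simplex {R} d.
Arguments orthant {R} d.
Arguments orthant0 {R} d.

(* Main.v *)
(** Fix [j] and put [s = 1/gamma].

    Doubling [t] repeatedly in the second-order condition on [X_j] gives
    [t^s P(X_j > t) = C + C (c/rho) t^rho + o(t^rho)] with [C > 0]; combined with the
    uniform density condition, [t^(d+s) f(t w) = C q(w) + t^rho (Psi(w) + o(1))]
    uniformly on the simplex.  Integrating this over the sets [{x >= 0, l1 x > u}],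
    where homogeneity under dilations replaces polar coordinates, yields
    [u^s P(R > u) = a0 + a1 u^rho + o(u^rho)] and
    [u^(s-1) E(X_j; R > u) = b0 + b1 u^rho + o(u^rho)].

    The inequalities [P(X_j > u) <= P(R > u)] and [u P(X_j > u) <= E(X_j; R > u)] give
    [a0, b0 >= C > 0].  The weak convergence of [W] identifies [wbar_j], and an integral
    identity for homogeneous functions gives [b0 = a0 wbar_j / (1 - gamma)].  Hence the
    relative error at level [u] is [c' u^rho + o(u^rho)].  It is evaluated at [u = U_R t];
    since [U_Y(t)^s / t] converges for both [Y = R] and [Y = X_j], replacing [u^rho] by
    [A_j (U_{X_j} t)] only changes the constant. *)
Require Import Defs.
From HB Require Import structures.
From mathcomp Require Import all_boot all_order all_algebra.
From mathcomp Require Import all_classical all_reals all_analysis.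
From mathcomp Require Import measurable_realfun ring lra.
Set Implicit Arguments. Unset Strict Implicit. Unset Printing Implicit Defensive.
Import Order.TTheory GRing.Theory Num.Theory.
Import numFieldNormedType.Exports.
Local Open Scope classical_set_scope.
Local Open Scope ring_scope.

(** * Lebesgue measure on tuples and densities *)

(** The ratio of [b0] to [a0 * wbar_j] comes from a radial integral. A function homogeneous of
    degree [- (d + t)] has, in polar coordinates, radial part [r ^ (- 1 - t)], whose integral over
    [r > 1] is [1 / t]; the angular factor does not depend on [t]. Weighting by [x_j] instead of
    [x_j / l1 x] lowers [t] from [s] to [s - 1], so the two limits have ratio
    [s / (s - 1) = 1 / (1 - gamma)]. Both lower bounds by [C] are used for division: [a0] is a
    denominator, and [b0 != 0] forces [wbar_j != 0], so that the normalisation in the conclusion is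
    a genuine quotient. Uniformity on the simplex suffices for integrating over an unbounded set:
    after rescaling, the error in the density is a small multiple of a fixed homogeneous function,
    integrable against the weights because their degree is below [s]. For the weight [x_j] of degree
    1 this is the assumption [gamma < 1]. *)

Section image_measure.
Context d d' (T : measurableType d) (T' : measurableType d') (R : realType).
Variables (m : {measure set T -> \bar R}) (phi : T -> T').
Hypothesis mphi : measurable_fun [set: T] phi.

Definition image_measure : {measure set T' -> \bar R}.
Proof. unshelve refine (pushforward m phi : measure _ _); exact: mphi. Defined.

Lemma image_measureE (A : set T') : image_measure A = m (phi @^-1` A).
Proof. by []. Qed.

Lemma ge0_integral_image (g : T' -> \bar R) :
  measurable_fun setT g -> (forall x, 0 <= g x)%E ->
  (\int[image_measure]_x g x = \int[m]_x g (phi x))%E.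
Proof. by move=> mg g0; rewrite ge0_integral_pushforward. Qed.

End image_measure.

Section sigma_finite_pack.
Context d (T : measurableType d) (R : realType).
Variables (mu : {measure set T -> \bar R}) (sf : sigma_finite setT mu).

(** Tonelli's theorem expects a measure carrying its sigma-finiteness as structure, while the
    induction on the dimension supplies a bare measure with a proof; this alias attaches the proof
    without changing any value. *)
Definition sigma_finite_pack_def of sigma_finite setT mu : set T -> \bar R := mu.

HB.instance Definition _ := Measure.copy (sigma_finite_pack_def sf) mu.

HB.instance Definition _ :=
  Measure_isSigmaFinite.Build _ _ _ (sigma_finite_pack_def sf) sf.

Definition sigma_finite_pack : {sigma_finite_measure set T -> \bar R} :=
  sigma_finite_pack_def sf.

End sigma_finite_pack.

Section tuple_lebesgue.
Local Open Scope ereal_scope.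
Context {R : realType}.
Notation leb := (@lebesgue_measure R).

(** The right-hand side is a measure in [A] that agrees with length on half-open intervals, and
    these determine Lebesgue measure. *)
Lemma lebesgue_measure_scale (c : R) (A : set R) : (0 < c)%R -> measurable A ->
  leb A = (c%:E * leb ((fun x => c * x)%R @^-1` A)).
Proof.
move=> c0 mA.
have cge0 : (0 <= c)%R by exact: ltW.
have mscl : measurable_fun setT (fun x : measurableTypeR R => (c * x)%R : measurableTypeR R).
  exact: measurable_funM.
pose mm : {measure set (measurableTypeR R) -> \bar R} :=
  mscale (NngNum cge0) (image_measure leb mscl).
rewrite (lebesgue_measure_unique (mu := mm)) //=.
move=> _ [[a b]] _ <-.
rewrite /mm /= /mscale/= (image_measureE leb mscl).
have -> : ((fun x => c * x) @^-1` `]a, b])%R = `](a / c)%R, (b / c)%R]%classic.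
  apply/seteqP; split=> x /=; rewrite !in_itv/= ltr_pdivrMr// ler_pdivlMr//;
  by rewrite mulrC.
rewrite lebesgue_measure_itv [X in _ = _ * X]lebesgue_measure_itv/= !lte_fin ltr_pM2r ?invr_gt0//.
case: ifP => _; last by rewrite mule0.
rewrite -EFinB -EFinM; congr EFin.
by rewrite -mulrBl mulrC divfK// gt_eqF.
Qed.

Lemma integral_scale (c : R) (g : R -> \bar R) : (0 < c)%R ->
  measurable_fun setT g -> (forall x, 0 <= g x) ->
  \int[leb]_x g (c * x)%R = (c^-1)%:E * \int[leb]_x g x.
Proof.
move=> c0 mg g0.
have cge0 : (0 <= c)%R by exact: ltW.
have mscl : measurable_fun setT (fun x : measurableTypeR R => (c * x)%R : measurableTypeR R).
  exact: measurable_funM.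
have -> : \int[leb]_x g x = \int[mscale (NngNum cge0) (image_measure leb mscl)]_x g x.
  apply: eq_measure_integral => A mA _.
  exact: (lebesgue_measure_scale c0 mA).
rewrite ge0_integral_mscale//= muleA -EFinM mulVf ?gt_eqF// mul1e.
by rewrite ge0_integral_image.
Qed.

Lemma tscale_cons (n : nat) (c x : R) (t : n.-tuple R) :
  tscale c (cons_tuple x t) = cons_tuple (c * x)%R (tscale c t).
Proof. exact/val_inj. Qed.

Lemma measurable_tscale (n : nat) (c : R) :
  measurable_fun [set: n.-tuple R] (@tscale R n c).
Proof.
apply/measurable_fun_tnthP => i.
rewrite (_ : _ \o _ = fun x : n.-tuple R => (c * tnth x i)%R); last first.
  by apply/funext => x /=; rewrite tnth_map.
by apply: measurable_funM => //; exact: measurable_tnth.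
Qed.

Lemma measurable_cons_pair (n : nat) :
  measurable_fun [set: R * n.-tuple R]
    (fun p : R * n.-tuple R => cons_tuple p.1 p.2).
Proof. exact: measurable_cons. Qed.

Lemma measurable_cons_tuple (n : nat) (x : R) :
  measurable_fun [set: n.-tuple R] (fun t : n.-tuple R => cons_tuple x t).
Proof. exact: measurable_cons. Qed.

(** Boxes serve twice: they exhaust the space, which gives sigma-finiteness, and their finite
    measure bounds the first shell in [integral_tail_powR_lty]. *)
Definition box (n : nat) (k : R) : set (n.-tuple R) :=
  [set x | forall i, (`|tnth x i| <= k)%R].

Lemma measurable_box (n : nat) (k : R) : measurable (@box n k).
Proof.
rewrite (_ : box k = \bigcap_(i in [set: 'I_n])
    [set x : n.-tuple R | (`|tnth x i| <= k)%R]); last first.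
  by apply/seteqP; split=> x /= H i => [_|]; exact: H.
apply: fin_bigcap_measurable => // i _.
have mt : measurable_fun [set: n.-tuple R] (fun x : n.-tuple R => `|tnth x i|%R).
  by apply: measurableT_comp => //; exact: measurable_tnth.
have := @measurable_fun_ler _ _ R setT _ (cst k) mt (measurable_cst _).
move/(_ measurableT [set true]).
rewrite setTI; exact.
Qed.

(** Realising the iterated integral [lebint] by a measure gives access to convergence theorems and
    integrability. The last clause is the Jacobian of a dilation, the only geometric fact about the
    measure that replaces polar coordinates. *)
Definition tuple_lebesgue_spec (n : nat)
    (mu : {measure set (n.-tuple R) -> \bar R}) :=
  [/\ forall k, mu (box k) < +oo,
      forall g, measurable_fun setT g -> (forall x, 0 <= g x) ->
        lebint g = \int[mu]_x g x &
      forall (c : R) g, (0 < c)%R -> measurable_fun setT g ->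
        (forall x, 0 <= g x) ->
        \int[mu]_x g (tscale c x) = (c ^- n)%:E * \int[mu]_x g x].

Lemma box_finite_sigma_finite (n : nat)
    (mu : {measure set (n.-tuple R) -> \bar R}) :
  (forall k, mu (box k) < +oo) -> sigma_finite setT mu.
Proof.
move=> muB; exists (fun k => box k%:R); last first.
  by move=> k; split; [exact: measurable_box|exact: muB].
apply/esym/seteqP; split=> // x _.
pose M := (\sum_(i < n) `|tnth x i|)%R.
exists (Num.truncn M).+1 => // i.
apply: le_trans (ltW (truncnS_gt _)).
by rewrite /M (bigD1 i)//= lerDl sumr_ge0.
Qed.

(** Induction on the dimension: a point mass at the empty tuple, then the image under [cons_tuple]
    of the product of the line with the previous measure. Tonelli gives the iterated integral, and
    scaling the two factors separately gives [c ^- n.+1]. *)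
Lemma tuple_lebesgue_exists (n : nat) : exists mu, @tuple_lebesgue_spec n mu.
Proof.
elim: n => [|n [mu [mub muint musc]]].
  exists (dirac ([tuple] : 0.-tuple R)); split.
  - by move=> k; rewrite /= diracE; case: (_ \in _); rewrite ltry.
  - by move=> g mg g0; rewrite integral_dirac// diracT mul1e.
  - move=> c g c0 mg g0.
    rewrite expr0 invr1 mul1e; apply: eq_integral => x _; congr g.
    by rewrite (tuple0 x); exact/val_inj.
pose m2 := sigma_finite_pack (box_finite_sigma_finite mub).
have mc := @measurable_cons_pair n.
pose nu := image_measure (leb \x m2) mc.
have fub g : measurable_fun setT g -> (forall x, 0 <= g x) ->
    \int[nu]_x g x = \int[leb]_x \int[mu]_t g (cons_tuple x t).
  move=> mg g0; rewrite ge0_integral_image//.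
  rewrite fubini_tonelli1//.
  exact: measurableT_comp.
exists nu; split.
- move=> k; change (nu _) with ((leb \x m2) ((fun p : R * n.-tuple R => cons_tuple p.1 p.2) @^-1` box k)).
  rewrite (_ : _ @^-1` _ = `[(- k)%R, k]%classic `*` box k); last first.
    apply/seteqP; split => -[x t] /=; rewrite in_itv/= -ler_norml.
      move=> H; split; first by have := H ord0; rewrite tnth0.
      by move=> i; have := H (lift ord0 i); rewrite tnthS.
    move=> [H1 H2] i; case: (unliftP ord0 i) => [j ->|->]; first by rewrite tnthS.
    by rewrite tnth0.
  rewrite product_measure1E//; last exact: measurable_box.
  rewrite lte_mul_pinfty//; last exact: mub.
  by rewrite [X in X \is a _]lebesgue_measure_itv/=; case: ifP.
- move=> g mg g0; rewrite fub//=.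
  apply: eq_integral => x _; apply: muint => //.
  exact: measurableT_comp mg (measurable_cons_tuple x).
- move=> c g c0 mg g0; rewrite fub//; last first.
    by apply: measurableT_comp => //; exact: measurable_tscale.
  rewrite fub//.
  under eq_integral => x _.
    under eq_integral do rewrite tscale_cons.
    rewrite (musc _ (fun t => g (cons_tuple (c * x)%R t)))//; last first.
      exact: measurableT_comp mg (measurable_cons_tuple _).
    over.
  have mF : measurable_fun setT (fun x => \int[mu]_t g (cons_tuple x t)).
    apply: (@measurable_fun_fubini_tonelli_F _ _ _ _ _ m2
      (fun p : measurableTypeR R * n.-tuple R => g (cons_tuple p.1 p.2))) => //.
    exact: measurableT_comp.
  have F0 x : 0 <= \int[mu]_t g (cons_tuple x t) by exact: integral_ge0.
  rewrite (@integral_scale c (fun x => (c ^- n)%:E * \int[mu]_t g (cons_tuple x t)))//.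
  + rewrite ge0_integralZl//; last by rewrite lee_fin invr_ge0 exprn_ge0// ltW.
    by rewrite muleA -EFinM -invfM -exprS.
  + exact: measurable_funeM.
  + by move=> x; rewrite mule_ge0// lee_fin invr_ge0 exprn_ge0// ltW.
Qed.

End tuple_lebesgue.

Section density.
Local Open Scope ereal_scope.
Context d (T : measurableType d) (R : realType).
Variables (nu mu : {measure set T -> \bar R}) (f : T -> \bar R).
Hypotheses (mf : measurable_fun setT f) (f0 : forall x, 0 <= f x).
Hypothesis ffin : forall x, f x \is a fin_num.
Hypothesis nuE : forall B, measurable B -> nu B = \int[mu]_(x in B) f x.

Import HBNNSimple.

(** [nuE] is the case of an indicator; linearity extends it to simple functions, and monotone
    convergence on both sides to [g]. *)
Lemma ge0_integral_density (g : T -> \bar R) :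
  measurable_fun setT g -> (forall x, 0 <= g x) ->
  \int[nu]_x g x = \int[mu]_x (g x * f x).
Proof.
move=> mg g0; pose h := nnsfun_approx measurableT mg.
have hg x : (EFin \o h^~ x) n @[n --> \oo] --> g x.
  exact: cvg_nnsfun_approx.
have mh n : measurable_fun setT (EFin \o h n) by exact/measurable_EFinP.
have ndh x a b : (a <= b)%N -> (h a x)%:E <= (h b x)%:E.
  by move=> ab; rewrite lee_fin; exact/lefP/nd_nnsfun_approx.
transitivity (limn (fun n => \int[nu]_x (h n x)%:E)).
  rewrite -monotone_convergence//; last first.
  - by move=> x _ a b; exact: ndh.
  - by move=> n x _; rewrite lee_fin.
  by apply: eq_integral => x _; apply/esym/cvg_lim => //; exact: hg.
transitivity (limn (fun n => \int[mu]_x ((h n x)%:E * f x))).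
  congr (limn _); apply/funext => n.
  have hE x : (h n x)%:E = \sum_(y \in range (h n)) (y * \1_(h n @^-1` [set y]) x)%:E.
    by rewrite [in LHS](fimfunE (h n)) -fsumEFin.
  under eq_integral do rewrite hE.
  have indich r : measurable_fun setT (fun x => (r * \1_(h n @^-1` [set r]) x)%:E).
    by apply/measurable_EFinP; exact: measurable_funM.
  rewrite ge0_integral_fsum//; last by move=> m y Ey; exact: nnfun_muleindic_ge0.
  under [RHS]eq_integral => x _.
    rewrite hE ge0_mule_fsuml; last by move=> y; exact: nnfun_muleindic_ge0.
    over.
  rewrite ge0_integral_fsum//; last 2 first.
  - by move=> y; apply: emeasurable_funM.
  - by move=> m y Ey; rewrite mule_ge0// nnfun_muleindic_ge0.
  apply: eq_fsbigr => r rhn.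
  under eq_integral do rewrite EFinM.
  rewrite integralZl_indic_nnsfun// integral_indic// setIT.
  have mr : measurable (h n @^-1` [set r]) by [].
  rewrite nuE//.
  under [RHS]eq_integral do rewrite EFinM -muleA.
  have r0 : (0 <= r)%R by move: rhn; rewrite inE => -[x _ <-].
  rewrite ge0_integralZl//; last 2 first.
  - by apply: emeasurable_funM => //; exact/measurable_EFinP.
  - by move=> x _; rewrite mule_ge0// lee_fin.
  congr (_ * _); rewrite integral_mkcond.
  by apply: eq_integral => x _; rewrite epatch_indic muleC.
rewrite -monotone_convergence//.
- apply: eq_integral => x _; apply/cvg_lim => //.
  by apply: cvgeZr => //; exact: hg.
- by move=> n; apply: emeasurable_funM => //; exact: mh.
- by move=> n x _; rewrite mule_ge0// lee_fin.
- by move=> x _ a b ab; rewrite lee_wpmul2r//; exact: ndh.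
Qed.
End density.

(** * Integrals over the sets of nonnegative vectors with large sum *)

Section powR_extra.
Context {R : realType}.
Implicit Types a p : R.

Lemma powRE a p : 0 < a -> a `^ p = expR (p * ln a).
Proof. by move=> a0; rewrite /powR gt_eqF. Qed.

Lemma powR_lt1 a p : 1 < a -> p < 0 -> a `^ p < 1.
Proof.
move=> a1 p0; rewrite powRE ?(lt_trans _ a1)// expR_lt1 nmulr_rlt0//.
by rewrite ln_gt0.
Qed.

Lemma powRN_le1 a p : 1 <= a -> 0 <= p -> a `^ (- p) <= 1.
Proof.
move=> a1 p0; rewrite -(powRr0 a); apply: ler_powR => //.
by rewrite oppr_le0.
Qed.

End powR_extra.

Section tail_integrals.
Context {R : realType} (d : nat).
Implicit Types (x : d.-tuple R) (g phi : d.-tuple R -> R).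

(** Dilation by [c] carries [tail u] onto [tail (c * u)], so every level reduces to [tail 1];
    [tail 0] is the cone of nonzero nonnegative vectors, where homogeneity is stated. *)
Definition tail (u : R) : set (d.-tuple R) :=
  [set x | (forall i, 0 <= tnth x i) /\ u < l1 x].

Lemma l1_tscale (c : R) x : l1 (tscale c x) = c * l1 x.
Proof. by rewrite /l1 mulr_sumr; apply: eq_bigr => i _; rewrite tnth_map. Qed.

Lemma tscaleA (a b : R) x : tscale a (tscale b x) = tscale (a * b) x.
Proof. by apply: eq_from_tnth => i; rewrite !tnth_map mulrA. Qed.

Lemma tscale1 x : tscale 1 x = x.
Proof. by apply: eq_from_tnth => i; rewrite tnth_map mul1r. Qed.

Lemma measurable_l1 : measurable_fun setT (@l1 R d).
Proof. by apply: measurable_sum => i; exact: measurable_tnth. Qed.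

Lemma measurable_l1_powR (p : R) :
  measurable_fun setT (fun x : d.-tuple R => l1 x `^ p).
Proof.
apply: (@measurableT_comp _ _ _ _ _ _ (@powR R ^~ p)) => //; exact: measurable_l1.
Qed.

Lemma measurable_nonneg_tuple :
  measurable [set x : d.-tuple R | forall i, 0 <= tnth x i].
Proof.
rewrite (_ : [set _ | _] = \bigcap_(i in [set: 'I_d])
    [set x : d.-tuple R | 0 <= tnth x i]); last first.
  by apply/seteqP; split=> x /= H i => [_|]; exact: H.
apply: fin_bigcap_measurable => // i _.
have := @measurable_fun_ler _ _ R setT (cst 0) _ (measurable_cst _)
  (@measurable_tnth _ R d i).
by move/(_ measurableT [set true]); rewrite setTI; exact.
Qed.

Lemma measurable_l1_gt (u : R) : measurable [set x : d.-tuple R | u < l1 x].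
Proof.
have := @measurable_fun_ltr _ _ R setT (cst u) _ (measurable_cst _) measurable_l1.
by move/(_ measurableT [set true]); rewrite setTI; exact.
Qed.

Lemma measurable_tail (u : R) : measurable (tail u).
Proof.
rewrite (_ : tail u = [set x | forall i, 0 <= tnth x i] `&` [set x | u < l1 x])//.
by apply: measurableI; [exact: measurable_nonneg_tuple|exact: measurable_l1_gt].
Qed.

Lemma measurable_shell (a b : R) : measurable (tail a `&` [set x | l1 x <= b]).
Proof.
rewrite (_ : _ `&` _ = tail a `\` [set x | b < l1 x]).
  by apply: measurableD; [exact: measurable_tail|exact: measurable_l1_gt].
by apply/seteqP; split=> x [? /= H]; split=> //=; move: H; rewrite leNgt => /negP.
Qed.

Lemma tailS (u v : R) : u <= v -> tail v `<=` tail u.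
Proof. by move=> uv x [x0 vx]; split=> //; exact: le_lt_trans vx. Qed.

Lemma tail_tscale (c u : R) x : 0 < c -> tail (c * u) (tscale c x) <-> tail u x.
Proof.
move=> c0; rewrite /tail /= l1_tscale ltr_pM2l//.
split=> -[H ?]; split=> // i; have := H i; rewrite tnth_map.
  by rewrite pmulr_rge0.
by move=> ?; rewrite mulr_ge0// ltW.
Qed.

Variable mu : {measure set (d.-tuple R) -> \bar R}.
Hypothesis muP : tuple_lebesgue_spec mu.

Lemma integral_preimage_tscale (c : R) (B : set (d.-tuple R))
    (g : d.-tuple R -> \bar R) : 0 < c ->
  measurable B -> measurable_fun B g -> (forall x, B x -> 0 <= g x)%E ->
  (\int[mu]_(x in B) g x =
   (c ^+ d)%:E * \int[mu]_(x in tscale c @^-1` B) g (tscale c x))%E.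
Proof.
move=> c0 mB mg g0; case: muP => _ _ musc.
rewrite integral_mkcond [in RHS]integral_mkcond.
rewrite (_ : (_ \_ (tscale c @^-1` B)) = fun x => (g \_ B) (tscale c x)); last first.
  by apply/funext => x; rewrite !patchE.
rewrite musc//.
- rewrite muleA -EFinM mulfV ?mul1e// expf_neq0//; exact: lt0r_neq0.
- by apply/(measurable_restrictT g).
- by move=> x; apply: erestrict_ge0.
Qed.

Lemma integral_tail_tscale (c u : R) (g : d.-tuple R -> \bar R) : 0 < c ->
  measurable_fun (tail (c * u)) g -> (forall x, tail (c * u) x -> 0 <= g x)%E ->
  (\int[mu]_(x in tail (c * u)) g x =
   (c ^+ d)%:E * \int[mu]_(x in tail u) g (tscale c x))%E.
Proof.
move=> c0 mg g0; rewrite (integral_preimage_tscale c0)//; last exact: measurable_tail.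
congr (_ * _)%E; congr (integral _ _ _).
by apply/seteqP; split=> x /=; rewrite tail_tscale.
Qed.

Lemma measurable_EFin_l1_powR (D : set (d.-tuple R)) (p : R) :
  measurable_fun D (fun x : d.-tuple R => (l1 x `^ p)%:E).
Proof. by apply/measurable_EFinP/measurable_funTS; exact: measurable_l1_powR. Qed.

(* Splitting off the first dyadic shell bounds the integral over [1 < l1 x <= 2 ^ n.+1] by a
   contraction of the one over [1 < l1 x <= 2 ^ n]. *)
Lemma integral_tail_powR_lty (p : R) : d%:R < p ->
  (\int[mu]_(x in tail 1) (l1 x `^ (- p))%:E < +oo)%E.
Proof.
move=> dp.
have p0 : 0 < p by exact: le_lt_trans dp.
pose F (n : nat) := tail 1 `&` [set x : d.-tuple R | l1 x <= 2 ^+ n].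
have mF n : measurable (F n) by exact: measurable_shell.
have mV n : measurable_fun (F n) (fun x => (l1 x `^ (- p))%:E).
  exact: measurable_EFin_l1_powR.
pose V n := (\int[mu]_(x in F n) (l1 x `^ (- p))%:E)%E.
have V1 : (V 1%N < +oo)%E.
  case: muP => mub _ _; apply: le_lt_trans (mub 2).
  rewrite -[leRHS]mul1e -integral_cst; last exact: measurable_box.
  apply: (@le_trans _ _ (\int[mu]_(x in F 1%N) (cst 1%E) x)%E).
    apply: ge0_le_integral => //.
    - by move=> x _; rewrite lee_fin powR_ge0.
    - by move=> x [[_ l1x] _]; rewrite lee_fin powRN_le1// ltW.
  apply: ge0_subset_integral => //; first exact: measurable_box.
  move=> x [[x0 _] /=]; rewrite expr1 => lx i.
  rewrite ger0_norm//; apply: le_trans lx.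
  by rewrite /l1 (bigD1 i)//= lerDl sumr_ge0.
(* Doubling multiplies volume by [2 ^ d] and the integrand by [2 ^ (- p)]; the product is a
   contraction exactly because [d < p]. *)
pose th : R := 2 `^ (d%:R - p).
have th1 : th < 1.
  by apply: powR_lt1; rewrite ?subr_lt0// ltr1n.
have VS n : (V n.+1 <= V 1%N + th%:E * V n)%E.
  have -> : (th%:E * V n = \int[mu]_(x in tail 2 `&` [set x | l1 x <= 2 ^+ n.+1]%R)
      (l1 x `^ (- p))%:E)%E.
    rewrite [RHS](@integral_preimage_tscale 2)//; last 3 first.
    - exact: measurable_shell.
    - exact: measurable_EFin_l1_powR.
    - by move=> x _; rewrite lee_fin powR_ge0.
    rewrite (_ : tscale 2 @^-1` _ = F n); last first.
      have t2 x : tail 2 (tscale 2 x) <-> tail 1 x.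
        by rewrite -[X in tail X _]mulr1 tail_tscale.
      by apply/seteqP; split=> x /=; rewrite /F /= l1_tscale exprS ler_pM2l// t2.
    under [in RHS]eq_integral => x.
      rewrite inE => -[[x0 l1x] _].
      rewrite l1_tscale powRM//; last by rewrite ltW// (lt_trans _ l1x).
      rewrite EFinM; over.
    rewrite ge0_integralZl//; last by move=> x _; rewrite lee_fin powR_ge0.
      rewrite muleA -EFinM /th powRD; last by rewrite pnatr_eq0 implybT.
      by rewrite powR_mulrn.
  rewrite -ge0_integral_setU//.
  - apply: ge0_subset_integral => //.
    + by apply: measurableU => //; exact: measurable_shell.
    + exact: measurable_EFin_l1_powR.
    + by move=> x _; rewrite lee_fin powR_ge0.
    + move=> x [[x0 l1x] /= lx]; case: (leP (l1 x) 2) => x2; first by left.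
      by right.
  - exact: measurable_shell.
  - exact: measurable_EFin_l1_powR.
  - by move=> x _; rewrite lee_fin powR_ge0.
  - apply/disj_setPS => x [[_ /=]]; rewrite expr1 => x2 [[_ +] _].
    by rewrite ltNge x2.
have V0 : V 0%N = 0%E.
  rewrite /V (_ : F 0%N = set0) ?integral_set0//.
  by apply/seteqP; split=> // x [[_ H1] /=]; rewrite expr0 leNgt H1.
(* The bound is the fixed point [K] of [K = V 1 + th * K]. *)
have VK n : (V n <= (fine (V 1%N) / (1 - th))%:E)%E.
  have V1ge0 : (0 <= V 1%N)%E by apply: integral_ge0 => x _; rewrite lee_fin powR_ge0.
  elim: n => [|n IH].
    by rewrite V0 lee_fin divr_ge0 ?subr_ge0 ?fine_ge0// ltW.
  apply: le_trans (VS n) _.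
  have Vfin : V 1%N \is a fin_num by rewrite ge0_fin_numE.
  apply: (@le_trans _ _ (V 1%N + th%:E * (fine (V 1%N) / (1 - th))%:E)%E).
    by rewrite leeD2l// lee_wpmul2l// lee_fin powR_ge0.
  rewrite -{1}(fineK Vfin) -EFinM -EFinD lee_fin.
  have th1' : 1 - th != 0 by rewrite subr_eq0 gt_eqF.
  by rewrite le_eqVlt; apply/orP; left; apply/eqP; field.
have Fnd : nondecreasing_seq F.
  move=> m n mn; apply/subsetPset => x [? /= H]; split=> //=.
  by apply: le_trans H _; rewrite ler_weXn2l// ler1n.
have Fcup : \bigcup_n F n = tail 1.
  apply/seteqP; split=> [x [n _ []//]|x tx].
  exists (Num.truncn (l1 x)).+1 => //; split=> //=.
  apply: le_trans (ltW (truncnS_gt _)) _.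
  by rewrite -natrX ler_nat ltnW// ltn_expl.
have := @ge0_nondecreasing_set_cvg_integral _ _ _ F
  (fun x => (l1 x `^ (- p))%:E) mu Fnd mF mV.
rewrite Fcup => Vcv0.
apply: le_lt_trans (ltry (fine (V 1%N) / (1 - th))).
have Vcv : V n @[n --> \oo] --> (\int[mu]_(x in tail 1) (l1 x `^ (- p))%:E)%E.
  by apply: Vcv0 => i x _; rewrite lee_fin powR_ge0.
rewrite -(cvg_lim _ Vcv)//; apply: lime_le; first by apply/cvg_ex; eexists; exact: Vcv.
by apply: nearW => n; exact: VK.
Qed.
End tail_integrals.

(** * Homogeneous integrands and the shift of their degree *)

Section tail_integrability.
Context {R : realType} (d : nat).
Implicit Types (x : d.-tuple R) (f g phi Phi Psi : d.-tuple R -> R).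
Variable mu : {measure set (d.-tuple R) -> \bar R}.
Hypothesis muP : tuple_lebesgue_spec mu.
Let T1 : set (d.-tuple R) := tail 1.
Let mT1 : measurable T1 := measurable_tail 1.

Lemma integrable_tail_powR (p M : R) phi : d%:R < p -> measurable_fun T1 phi ->
  (forall x, T1 x -> `|phi x| <= M * l1 x `^ (- p)) ->
  mu.-integrable T1 (EFin \o phi).
Proof.
move=> dp mphi phiM.
apply: (@le_integrable _ _ _ _ _ mT1 _ (fun x => M%:E * (l1 x `^ (- p))%:E)%E).
- exact/measurable_EFinP.
- move=> x Tx /=; rewrite lee_fin; apply: le_trans (phiM x Tx) _.
  exact: ler_norm.
- apply: integrableZl => //; apply/integrableP; split.
    exact: measurable_EFin_l1_powR.
  rewrite (eq_integral (fun x => (l1 x `^ (- p))%:E)); last first.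
    by move=> x _; rewrite gee0_abs// lee_fin powR_ge0.
  exact: integral_tail_powR_lty.
Qed.

Section index_shift.
Variables (s M : R) (phi : d.-tuple R -> R).
Hypotheses (s1 : 1 < s) (mphi : measurable_fun T1 phi).
Hypothesis phi0M : forall x, T1 x -> 0 <= phi x <= M.
Hypothesis phiH : forall c x, 1 <= c -> T1 x -> phi (tscale c x) = phi x.

Let F (t : R) x := l1 x `^ (- (d%:R + t)) * phi x.

Let mF t : measurable_fun T1 (F t).
Proof.
by apply: measurable_funM => //; apply: measurable_funTS; exact: measurable_l1_powR.
Qed.

Let F0 t x : T1 x -> 0 <= F t x.
Proof. by move=> /phi0M/andP[p0 _]; rewrite mulr_ge0// powR_ge0. Qed.

Lemma integrable_homogeneous t : 0 < t -> mu.-integrable T1 (EFin \o F t).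
Proof.
move=> t0; apply: (@integrable_tail_powR (d%:R + t) M) => //.
  by rewrite ltrDl.
move=> x Tx; rewrite ger0_norm ?F0// /F mulrC ler_wpM2r ?powR_ge0//.
by case/andP: (phi0M Tx).
Qed.

Let iF := integrable_homogeneous.

Let I t := \int[mu]_(x in T1) F t x.

(** The complement of the shell is the dilate of [T1] by [expR v]. Since [F t] is homogeneous of
    degree [- (d + t)] and volume scales with exponent [d], this complement carries the fraction
    [expR (- (t * v))] of the integral. *)
Let shell_integral (t v : R) : 0 < t -> 0 < v ->
  \int[mu]_(x in T1 `&` [set x | l1 x <= expR v]) F t x =
  (1 - expR (- (t * v))) * I t.
Proof.
move=> t0 v0; set q := expR v.
have q1 : 1 < q by rewrite expR_gt1.
have q0 : 0 < q by exact: lt_trans q1.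
have T1E : T1 = (T1 `&` [set x | l1 x <= q]) `|` tail q.
  apply/seteqP; split=> x.
    move=> [x0 lx]; case: (leP (l1 x) q) => xq; first by left.
    by right.
  by case=> [[//]|]; apply: tailS; exact: ltW.
have tailqI : \int[mu]_(x in tail q) F t x = expR (- (t * v)) * I t.
  rewrite /I /Rintegral -{1}(mulr1 q) (integral_tail_tscale muP)//; last 2 first.
  - rewrite mulr1; apply/measurable_EFinP; apply: measurable_funS (@mF t) => //.
    by apply: tailS; exact: ltW.
  - move=> x; rewrite mulr1 => /(tailS (ltW q1)) Tx.
    by rewrite lee_fin F0.
  under [X in fine (_ * X)]eq_integral => x.
    rewrite inE => Tx; rewrite /F phiH//; last exact: ltW.
    rewrite l1_tscale powRM//; [|exact: ltW|by case: Tx => _ /(lt_trans ltr01)/ltW].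
    rewrite -mulrA EFinM; over.
  rewrite integralZl//; last exact: iF.
  rewrite muleA -EFinM fineM//; last first.
    by apply: integrable_fin_num => //; exact: iF.
  rewrite /=; congr (_ * _).
  rewrite -powR_mulrn ?(ltW q0)// !powRE// -expRD expRK; congr expR; ring.
have := iF t0; rewrite {1}T1E => iFU.
have : I t = \int[mu]_(x in T1 `&` [set x | l1 x <= q]) F t x +
    \int[mu]_(x in tail q) F t x.
  rewrite /I {1}T1E Rintegral_setU//.
  - exact: measurable_shell.
  - exact: measurable_tail.
  - apply/disj_setPS => x [[_ /= +] [_ +]].
    by rewrite leNgt => /negP.
by rewrite tailqI; lra.
Qed.

(* On the shell [1 < l1 x <= expR v] the two integrands differ by the factor [l1 x], which
   lies between [1] and [expR v], and by homogeneity the shell carries the fraction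
   [1 - expR (- t v)] of the whole integral; let [v] tend to [0]. *)
Lemma tail_index_shift :
  (s - 1) * \int[mu]_(x in T1) F (s - 1) x = s * \int[mu]_(x in T1) F s x.
Proof.
rewrite -/(I (s - 1)) -/(I s).
have s10 : 0 < s - 1 by rewrite subr_gt0.
have s0 : 0 < s by exact: lt_trans s1.
have I0 t : 0 <= I t by apply: Rintegral_ge0 => x Tx; exact: F0.
have iFS t v : 0 < t -> mu.-integrable (T1 `&` [set x | l1 x <= expR v]) (EFin \o F t).
  by move=> t0; apply: integrableS (iF t0) => //; exact: measurable_shell.
have FS x : T1 x -> F (s - 1) x = l1 x * F s x.
  move=> Tx; have lx : 0 < l1 x by case: Tx => _ /(lt_trans ltr01).
  rewrite /F mulrA; congr (_ * _).
  rewrite -{2}(powRr1 (ltW lx)) -powRD ?(gt_eqF lx) ?implybT//.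
  by congr powR; ring.
have lo v : 0 < v -> (1 - expR (- (s * v))) * I s <=
    (1 - expR (- ((s - 1) * v))) * I (s - 1).
  move=> v0; rewrite -!shell_integral//; apply: le_Rintegral => //.
  - exact: measurable_shell.
  - exact: iFS.
  - exact: iFS.
  - move=> x [Tx _]; rewrite FS// ler_peMl ?F0//.
    by case: Tx => _ /ltW.
have hi v : 0 < v -> (1 - expR (- ((s - 1) * v))) * I (s - 1) <=
    expR v * ((1 - expR (- (s * v))) * I s).
  move=> v0; rewrite -!shell_integral// -RintegralZl; last 2 first.
  - exact: measurable_shell.
  - exact: iFS.
  apply: le_Rintegral => //.
  - exact: measurable_shell.
  - exact: iFS.
  - exact: (integrableZl (measurable_shell _ _) (expR v) (iFS _ _ s0)).
  - by move=> x [Tx /= xq]; rewrite FS// ler_wpM2r// F0.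
(* Together with [elb] this says that [1 - expR (- y)] is [y] up to a term of order [y ^ 2], so the
   shell fractions are linear in [v] to first order. *)
have eub (y : R) : 1 - expR (- y) <= y by have := expR_ge1Dx (- y); lra.
have elb (y : R) : 0 <= y -> y * (1 - y) <= 1 - expR (- y).
  move=> y0; have := expR_ge1Dx y; have := expR_ge1Dx (- y).
  have : expR (- y) * expR y = 1 by rewrite -expRD addNr expR0.
  have := expR_gt0 (- y).
  move: (expR (- y)) (expR y) => a b; nra.
have small (a b K : R) : 0 <= K ->
    (forall v, 0 < v -> v <= 2^-1 -> a <= b + v * K) -> a <= b.
  move=> K0 H; apply/ler_addgt0Pr => e e0.
  have K1 : 0 < K + 1 by lra.
  have [h|h] := leP (e / (K + 1)) 2^-1.
    apply: le_trans (H _ (divr_gt0 e0 K1) h) _.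
    rewrite lerD2l mulrAC ler_pdivrMr//; nra.
  have h2 : (0 : R) < 2^-1 by rewrite invr_gt0.
  have := H _ h2 (lexx _).
  move: h; rewrite ltr_pdivlMr//; lra.
have Is := I0 s; have Is1 := I0 (s - 1).
apply/eqP; rewrite eq_le; apply/andP; split.
(* After division by [v], the first summand is the cost of [expR v <= 1 + 2 * v] and the second that
   of the quadratic term in [elb]. *)
- apply: (small _ _ (2 * s * I s + (s - 1) ^+ 2 * I (s - 1))).
    by rewrite addr_ge0// mulr_ge0// ?sqr_ge0// mulr_ge0// ltW.
  move=> v v0 v2.
  have ev : expR v <= 1 + 2 * v.
    have : expR (- v) * expR v = 1 by rewrite -expRD addNr expR0.
    have := expR_ge1Dx (- v); have := expR_gt0 v.
    move: (expR (- v)) (expR v) => a b; nra.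
  have h1 : (s - 1) * v * (1 - (s - 1) * v) * I (s - 1) <= (1 + 2 * v) * (s * v * I s).
    apply: le_trans (le_trans (hi _ v0) _); first by rewrite ler_wpM2r// elb// mulr_ge0// ltW.
    apply: ler_pM => //.
    - rewrite mulr_ge0// subr_ge0 -expR0 ler_expR oppr_le0 mulr_ge0// ltW//.
    - by rewrite ler_wpM2r.
  rewrite -(ler_pM2l v0); move: h1; lra.
- apply: (small _ _ (s ^+ 2 * I s)); first by rewrite mulr_ge0// sqr_ge0.
  move=> v v0 v2.
  have h1 : s * v * (1 - s * v) * I s <= (s - 1) * v * I (s - 1).
    apply: le_trans (le_trans (lo _ v0) _); first by rewrite ler_wpM2r// elb// mulr_ge0// ltW.
    by rewrite ler_wpM2r.
  rewrite -(ler_pM2l v0); move: h1; lra.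
Qed.
End index_shift.
End tail_integrability.

(** * Second-order expansion of weighted tail integrals *)

Section tail_expansion.
Context {R : realType} (d : nat).
Implicit Types (x : d.-tuple R).
Variable mu : {measure set (d.-tuple R) -> \bar R}.
Hypothesis muP : tuple_lebesgue_spec mu.
Let T1 : set (d.-tuple R) := tail 1.
Let mT1 : measurable T1 := measurable_tail 1.

Variables (s rho k M : R) (f g Phi Psi : d.-tuple R -> R).
Hypotheses (rho0 : rho < 0) (ks : k < s).
Hypotheses (mf : measurable_fun setT f) (f0 : forall x, 0 <= f x).
Hypothesis mg : measurable_fun setT g.
Hypothesis g_bnd : forall x, tail 0 x -> 0 <= g x <= l1 x `^ k.
Hypothesis g_hom : forall c x, 0 < c -> tail 0 x -> g (tscale c x) = c `^ k * g x.
Hypotheses (mPhi : measurable_fun T1 Phi) (mPsi : measurable_fun T1 Psi).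
Hypotheses (PhiM : forall x, T1 x -> `|Phi x| <= M)
           (PsiM : forall x, T1 x -> `|Psi x| <= M).
Let P x := l1 x `^ (- (d%:R + s)).
Let Q x := l1 x `^ rho.
Hypothesis fE : forall e, 0 < e -> exists B, forall u, B <= u -> forall x, T1 x ->
  `|u `^ (d%:R + s) * f (tscale u x) - P x * Phi x - u `^ rho * (P x * Q x * Psi x)|
  <= e * (u `^ rho * (P x * Q x)).

Let G u := (\int[mu]_(x in tail u) (g x * f x)%:E)%E.
(** The integrand of [G u] pulled back to [T1] and normalised so as to approach
    [g x * (P x * Phi x)]. *)
Let F u x := g x * (u `^ (d%:R + s) * f (tscale u x)).

Let T10 x : T1 x -> tail 0 x.
Proof. exact: tailS. Qed.

Let mP : measurable_fun T1 P.
Proof. by apply: measurable_funTS; exact: measurable_l1_powR. Qed.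

Let mQ : measurable_fun T1 Q.
Proof. by apply: measurable_funTS; exact: measurable_l1_powR. Qed.

Let mg1 : measurable_fun T1 g.
Proof. exact: measurable_funTS. Qed.

Let mfu u : measurable_fun setT (fun x => f (tscale u x)).
Proof. by apply: measurableT_comp => //; exact: measurable_tscale. Qed.

Let mF u : measurable_fun T1 (F u).
Proof.
by apply: measurable_funM => //; apply: measurable_funM => //; apply: measurable_funTS.
Qed.

Let l1_gt1 x : T1 x -> 1 < l1 x. Proof. by case. Qed.

Let gP x : T1 x -> g x * P x <= l1 x `^ (- (d%:R + s - k)).
Proof.
move=> Tx; have lx0 : 0 < l1 x by exact: lt_trans (l1_gt1 Tx).
rewrite (_ : - (d%:R + s - k) = k + - (d%:R + s)); last by ring.
rewrite powRD ?(gt_eqF lx0) ?implybT// ler_wpM2r ?powR_ge0//.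
by case/andP: (g_bnd (T10 Tx)).
Qed.

Let Q1 x : T1 x -> 0 <= Q x <= 1.
Proof.
move=> Tx; rewrite powR_ge0 /= ltW// powR_lt1//; exact: l1_gt1.
Qed.

(** The product of [g] and [P] decays with exponent [d + s - k], which exceeds the critical exponent
    [d] because [k < s]. *)
Let integrable_gP (psi : d.-tuple R -> R) (N : R) : measurable_fun T1 psi ->
  (forall x, T1 x -> `|psi x| <= N) ->
  mu.-integrable T1 (EFin \o (fun x => g x * (P x * psi x))).
Proof.
move=> mpsi psiN; apply: (@integrable_tail_powR _ _ _ muP (d%:R + s - k) N).
- by rewrite -addrA ltrDl subr_gt0.
- by apply: measurable_funM => //; exact: measurable_funM.
- move=> x Tx; have /andP[g0 _] := g_bnd (T10 Tx).
  rewrite mulrA normrM [X in X * _]ger0_norm ?mulr_ge0 ?powR_ge0//.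
  by rewrite mulrC ler_pM ?psiN ?gP// mulr_ge0// powR_ge0.
Qed.

(** The exponent collects [d] from the volume, [k] from the degree of [g], and [- (d + s)] from the
    normalisation in [F]. *)
Let G_F u : 0 < u -> G u = ((u `^ (k - s))%:E * \int[mu]_(x in T1) (F u x)%:E)%E.
Proof.
move=> u0; rewrite /G -{1}(mulr1 u) (integral_tail_tscale muP)//; last 2 first.
- by apply/measurable_EFinP/measurable_funTS; exact: measurable_funM.
- move=> x; rewrite mulr1 => /(tailS (ltW u0)) /g_bnd /andP[g0 _].
  by rewrite lee_fin mulr_ge0.
have -> : (\int[mu]_(x in tail 1) (g (tscale u x) * f (tscale u x))%:E =
  \int[mu]_(x in T1) ((u `^ (k - (d%:R + s)))%:E * (F u x)%:E))%E.
  apply: eq_integral => x; rewrite inE => Tx; rewrite -EFinM; congr EFin.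
  rewrite g_hom//; last exact: T10.
  rewrite /F powRB ?(gt_eqF u0) ?implybT//.
  have /gt_eqF u1 : 0 < u `^ (d%:R + s) by exact: powR_gt0.
  by field; rewrite u1.
rewrite ge0_integralZl//; last 3 first.
- exact/measurable_EFinP.
- move=> x /T10 /g_bnd /andP[g0 _]; rewrite lee_fin /F.
  by do 2 rewrite mulr_ge0// ?powR_ge0.
- by rewrite lee_fin powR_ge0.
rewrite muleA -EFinM -powR_mulrn ?(ltW u0)// -powRD ?(gt_eqF u0) ?implybT//.
by congr (_%:E * _)%E; congr powR; ring.
Qed.

Let integrable_F e B u : 0 < e -> 1 <= u -> B <= u ->
  (forall u, B <= u -> forall x, T1 x ->
  `|u `^ (d%:R + s) * f (tscale u x) - P x * Phi x - u `^ rho * (P x * Q x * Psi x)|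
  <= e * (u `^ rho * (P x * Q x))) -> mu.-integrable T1 (EFin \o F u).
Proof.
move=> e0 u1 Bu H; have u0 : 0 < u by exact: lt_le_trans u1.
have ur1 : 0 <= u `^ rho <= 1.
  by rewrite powR_ge0 /= -[rho]opprK powRN_le1// oppr_ge0 ltW.
have iA := integrable_gP mPhi PhiM.
apply: (@integrable_tail_powR _ _ _ muP (d%:R + s - k) (2 * M + e)).
- by rewrite -addrA ltrDl subr_gt0.
- exact: mF.
move=> x Tx; have /andP[g0 _] := g_bnd (T10 Tx).
rewrite /F ger0_norm; last by do 2 rewrite mulr_ge0// ?powR_ge0.
have hx := H u Bu x Tx.
have P0 : 0 <= P x by exact: powR_ge0.
have /andP[Q0 Q1x] := Q1 Tx; have /andP[r0 r1] := ur1.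
have M1 := PhiM Tx; have M2 := PsiM Tx.
apply: (@le_trans _ _ (g x * (P x * (2 * M + e)))).
  rewrite ler_wpM2l//.
  have rQ : 0 <= u `^ rho * Q x <= 1 by rewrite mulr_ge0// mulr_ile1.
  have hx' : u `^ (d%:R + s) * f (tscale u x) <=
     P x * (Phi x + (u `^ rho * Q x) * Psi x + e * (u `^ rho * Q x)).
    by move: hx => /ler_normlP [_ +]; lra.
  apply: le_trans hx' _; rewrite ler_wpM2l//.
  move: rQ => /andP[]; move: (u `^ rho * Q x) => w w0 w1.
  have : Phi x <= M by apply: le_trans M1; exact: ler_norm.
  have : w * Psi x <= M.
    apply: le_trans M2; apply: le_trans (ler_norm _) _.
    by rewrite normrM ger0_norm// ler_piMl.
  have : e * w <= e by rewrite ler_piMr// ltW.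
  lra.
rewrite mulrA mulrC ler_wpM2l ?gP//.
by have := le_trans (normr_ge0 _) M1; lra.
Qed.

(** Finiteness needs its own statement because [fine] sends [+oo] to 0: a lower bound on [G u]
    passes to [fine (G u)] only once [G u] is known to be finite. *)
Lemma tail_integral_lty : \forall u \near +oo, (G u < +oo)%E.
Proof.
have [B HB] := fE ltr01.
near=> u.
have u0 : 0 < u by near: u; apply: nbhs_pinfty_gt; exact: num_real.
rewrite G_F//.
apply: lte_mul_pinfty => //; first by rewrite lee_fin powR_ge0.
apply: integrable_lty => //; apply: (integrable_F ltr01 _ _ HB).
  by near: u; apply: nbhs_pinfty_ge; exact: num_real.
by near: u; apply: nbhs_pinfty_ge; rewrite num_real.
Unshelve. all: end_near. Qed.

(** [fE] is integrated against [g]. Its error has the fixed integrable profile [g x * (P x * Q x)],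
    so a pointwise factor [e] becomes a factor [e * N] of [u ^ rho]. *)
Lemma tail_integral_expansion :
  u `^ (- rho) * (u `^ (s - k) * fine (G u) - \int[mu]_(x in T1) (g x * (P x * Phi x)))
    @[u --> +oo] --> \int[mu]_(x in T1) (g x * (P x * (Q x * Psi x))).
Proof.
set G0 := \int[mu]_(x in T1) (g x * (P x * Phi x)).
set G1 := \int[mu]_(x in T1) (g x * (P x * (Q x * Psi x))).
have i0 := integrable_gP mPhi PhiM.
have mQPsi : measurable_fun T1 (fun x => Q x * Psi x) by exact: measurable_funM.
have i1 : mu.-integrable T1 (EFin \o (fun x => g x * (P x * (Q x * Psi x)))).
  apply: (@integrable_gP (fun x => Q x * Psi x) M) => // x Tx.
  have /andP[Q0 Q1x] := Q1 Tx; apply: le_trans (PsiM Tx).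
  by rewrite normrM ger0_norm// ler_piMl.
have i2 : mu.-integrable T1 (EFin \o (fun x => g x * (P x * Q x))).
  apply: (@integrable_gP Q 1) => // x Tx.
  by have /andP[Q0 Q1x] := Q1 Tx; rewrite ger0_norm.
pose N := \int[mu]_(x in T1) (g x * (P x * Q x)).
have N0 : 0 <= N.
  apply: Rintegral_ge0 => x Tx; have /andP[g0 _] := g_bnd (T10 Tx).
  by rewrite !mulr_ge0// powR_ge0.
apply/cvgrPdist_le => e e0.
(* [N] itself may be zero, hence the shift by 1. *)
have e'0 : 0 < e / (N + 1) by rewrite divr_gt0// ltr_wpDl.
have [B HB] := fE e'0.
near=> u.
have u1 : 1 <= u by near: u; apply: nbhs_pinfty_ge; exact: num_real.
have Bu : B <= u by near: u; apply: nbhs_pinfty_ge; rewrite num_real.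
have u0 : 0 < u by exact: lt_le_trans u1.
have iF := integrable_F e'0 u1 Bu HB.
have ur0 : 0 < u `^ rho by exact: powR_gt0.
have -> : u `^ (s - k) * fine (G u) = \int[mu]_(x in T1) F u x.
  rewrite G_F// fineM//; last by apply: integrable_fin_num.
  rewrite /= mulrA -powRD ?(gt_eqF u0) ?implybT//.
  by rewrite (_ : _ + _ = 0) ?powRr0 ?mul1r//; ring.
have iA : mu.-integrable T1 (EFin \o (fun x => F u x - g x * (P x * Phi x))).
  exact: (integrableB mT1 iF i0).
have iB : mu.-integrable T1
    (EFin \o (fun x => u `^ rho * (g x * (P x * (Q x * Psi x))))).
  exact: (integrableZl mT1 (u `^ rho) i1).
have iN : mu.-integrable T1 (EFin \o (fun x => u `^ rho * (g x * (P x * Q x)))).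
  exact: (integrableZl mT1 (u `^ rho) i2).
have key : `|\int[mu]_(x in T1) F u x - G0 - u `^ rho * G1| <= e / (N + 1) * (u `^ rho * N).
  rewrite /G0 /G1 /N -!RintegralZl//.
  rewrite -RintegralB// -RintegralB//.
  have iC : mu.-integrable T1 (EFin \o (fun x => F u x - g x * (P x * Phi x) -
     u `^ rho * (g x * (P x * (Q x * Psi x))))).
    exact: (integrableB mT1 iA iB).
  apply: le_trans (le_normr_Rintegral mT1 iC) _.
  apply: le_Rintegral => //.
  - exact: integrable_norm.
  - exact: (integrableZl mT1 _ iN).
  move=> x Tx; have /andP[g0 _] := g_bnd (T10 Tx).
  rewrite (_ : F u x - _ - _ = g x * (u `^ (d%:R + s) * f (tscale u x) -
    P x * Phi x - u `^ rho * (P x * Q x * Psi x))); last by rewrite /F; ring.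
  rewrite normrM ger0_norm// (_ : e / _ * _ = g x * (e / (N + 1) * (u `^ rho * (P x * Q x)))); last first.
    by rewrite /=; ring.
  by rewrite ler_wpM2l// HB.
rewrite distrC powRN.
rewrite (_ : _ - G1 = (u `^ rho)^-1 * (\int[mu]_(x in T1) F u x - G0 - u `^ rho * G1)); last first.
  by field; rewrite gt_eqF.
rewrite normrM ger0_norm ?invr_ge0 ?(ltW ur0)// mulrC ler_pdivrMr//.
apply: le_trans key _; rewrite mulrCA mulrC ler_wpM2r ?(ltW ur0)//.
rewrite mulrAC ler_pdivrMr ?ltr_wpDl// ler_wpM2l ?(ltW e0)//.
by rewrite lerDl.
Unshelve. all: end_near. Qed.

End tail_expansion.

(** * Second-order asymptotics of a tail function *)

Section limits_at_infinity.
Context {R : realType}.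

Lemma near_cvg_eq (f g : R -> R) (l : R) : (\forall t \near +oo, f t = g t) ->
  f t @[t --> +oo] --> l -> g t @[t --> +oo] --> l.
Proof. by move=> fg; apply: cvg_trans; exact: near_eq_cvg. Qed.

Lemma cvgyD (f g : R -> R) (a b : R) : f t @[t --> +oo] --> a ->
  g t @[t --> +oo] --> b -> f t + g t @[t --> +oo] --> a + b.
Proof. exact: cvgD. Qed.

Lemma cvgyB (f g : R -> R) (a b : R) : f t @[t --> +oo] --> a ->
  g t @[t --> +oo] --> b -> f t - g t @[t --> +oo] --> a - b.
Proof. exact: cvgB. Qed.

Lemma cvgyM (f g : R -> R) (a b : R) : f t @[t --> +oo] --> a ->
  g t @[t --> +oo] --> b -> f t * g t @[t --> +oo] --> a * b.
Proof. exact: cvgM. Qed.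

Lemma cvgy_cst (a : R) : a @[t --> (+oo : set_system R)] --> a.
Proof. exact: cvg_cst. Qed.

Lemma near_pinfty_scale (x : R) (Pr : R -> Prop) : 0 < x ->
  (\forall t \near +oo, Pr t) -> \forall t \near +oo, Pr (t * x).
Proof.
move=> x0 [B [Br HB]]; exists (B / x); split; first exact: num_real.
by move=> t Bt; apply: HB; rewrite -ltr_pdivrMr.
Qed.

Lemma near_pinfty_ex (Pr : R -> Prop) : (\forall t \near +oo, Pr t) ->
  exists B, forall t, B <= t -> Pr t.
Proof.
move=> [B [_ HB]]; exists (B + 1) => t Bt; apply: HB.
by apply: lt_le_trans Bt; rewrite ltrDl.
Qed.

Lemma powR_pinfty_ge (c p B : R) : 0 < c -> 0 < p ->
  \forall t \near +oo, B <= (c * t) `^ p.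
Proof.
move=> c0 p0; pose B' := Num.max B 0.
have B'0 : 0 <= B' by rewrite le_max lexx orbT.
near=> t; apply: (@le_trans _ _ B'); first by rewrite le_max lexx.
have -> : B' = (B' `^ p^-1) `^ p by rewrite -powRrM mulVf ?powRr1// gt_eqF.
have h : B' `^ p^-1 / c <= t by near: t; apply: nbhs_pinfty_ge; exact: num_real.
have h' : B' `^ p^-1 <= c * t by rewrite mulrC -ler_pdivrMr.
rewrite ge0_ler_powR// ?nnegrE ?powR_ge0 ?(ltW p0)//.
by apply: le_trans h'; exact: powR_ge0.
Unshelve. all: end_near. Qed.

Lemma powR_pinfty_cvg0 (rho : R) : rho < 0 -> t `^ rho @[t --> +oo] --> 0.
Proof.
move=> r0; apply/cvgrPdist_le => e e0.
have ei0 : 0 < e `^ (rho^-1) by exact: powR_gt0.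
near=> t.
have te : e `^ (rho^-1) <= t by near: t; apply: nbhs_pinfty_ge; exact: num_real.
have t0 : 0 < t by exact: lt_le_trans te.
rewrite sub0r normrN ger0_norm ?powR_ge0//.
rewrite -[rho]opprK powRN -[leRHS]invrK lef_pV2 ?posrE ?invr_gt0 ?powR_gt0//.
have -> : e^-1 = (e `^ rho^-1) `^ (- rho).
  by rewrite -powRrM mulrN mulVf ?lt_eqF// powR_inv1// ltW.
by rewrite ge0_ler_powR// ?nnegrE ?powR_ge0 ?oppr_ge0// ltW.
Unshelve. all: end_near. Qed.

(* The hypothesis is only pointwise in [x]: [x = 2] makes [m (t 2^n)] converge as [n] grows,
   with the required rate, and the other values of [x] show that the limit is the same
   for all [t]. *)
Lemma cvg_pinfty_shift_limit (m : R -> R) (rho : R) : rho < 0 ->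
  (forall x, 0 < x -> t `^ (- rho) * (m (t * x) - m t) @[t --> +oo] --> 0) ->
  exists minf, t `^ (- rho) * (m t - minf) @[t --> +oo] --> 0.
Proof.
move=> r0 H.
pose th : R := 2 `^ rho.
have th1 : th < 1 by apply: powR_lt1 => //; rewrite ltr1n.
(* Sum of the geometric series of [th]: the increments of [m] along [t * 2 ^ k] are at most
   [e * th ^ k * t ^ rho]. *)
pose sg := (1 - th)^-1.
have sg0 : 0 < sg by rewrite invr_gt0 subr_gt0.
have sgE : sg * th + 1 = sg by rewrite /sg; field; rewrite subr_eq0 gt_eqF.
have dbl e : 0 < e -> exists2 B, 0 < B & forall t, B <= t -> forall n,
    `|m (t * 2 ^+ n) - m t| <= e * sg * t `^ rho.
  move=> e0; have /cvgrPdist_le /(_ e e0) := H 2 (ltr0Sn _ _).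
  move=> [B [_ HB]]; pose B' := Num.max B 0 + 1.
  have B'0 : 0 < B' by rewrite ltr_wpDl// le_max lexx orbT.
  exists B' => // t Bt n.
  have step z : B' <= z -> `|m (z * 2) - m z| <= e * z `^ rho.
    move=> Bz; have z0 : 0 < z by exact: lt_le_trans Bz.
    have := HB z; rewrite sub0r normrN normrM powRN ger0_norm ?invr_ge0 ?powR_ge0//.
    rewrite mulrC ler_pdivrMr ?powR_gt0//; apply.
    by apply: lt_le_trans Bz; rewrite ltr_pwDr// le_max lexx.
  elim: n t Bt => [|n IH] t Bt.
    by rewrite expr0 mulr1 subrr normr0 !mulr_ge0 ?powR_ge0// ltW.
  have t0 : 0 < t by exact: lt_le_trans Bt.
  rewrite (_ : _ - _ = (m (t * 2 * 2 ^+ n) - m (t * 2)) + (m (t * 2) - m t)); last first.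
    by rewrite exprS mulrA; ring.
  apply: le_trans (ler_normD _ _) _.
  have B2 : B' <= t * 2 by apply: le_trans Bt _; rewrite ler_pMr// ler1n.
  apply: le_trans (lerD (IH _ B2) (step _ Bt)) _.
  rewrite powRM//; last exact: ltW.
  by rewrite -/th -{2}sgE le_eqVlt; apply/orP; left; apply/eqP; ring.
pose u n := m (2 ^+ n).
have pow2 : (2 ^+ n : R) @[n --> \oo] --> +oo.
  apply/cvgryPge => B; near=> n.
  apply: (@le_trans _ _ n%:R); first by near: n; exact: nbhs_infty_ger.
  by rewrite -natrX ler_nat ltnW// ltn_expl.
have ucv : cvg (u n @[n --> \oo]).
  apply: cauchy_cvg; apply: cauchy_exP => e e0.
  have [B B0 HB] := dbl 1 ltr01.
  have th_cv := powR_pinfty_cvg0 r0.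
  have sge : 0 < e / (2 * sg) by rewrite divr_gt0// mulr_gt0.
  have : \forall n \near \oo, B <= 2 ^+ n :> R /\ (2 ^+ n) `^ rho <= e / (2 * sg).
    near=> n; split; first by near: n; move/cvgryPge : pow2; exact.
    have : `|0 - (2 ^+ n) `^ rho| <= e / (2 * sg).
      near: n; have := cvg_comp _ _ pow2 th_cv.
      by move/cvgrPdist_le => /(_ _ sge).
    by rewrite sub0r normrN ger0_norm// powR_ge0.
  move=> [N _ HN]; exists (u N); exists N => // n /= Nn.
  have [h1 h2] := HN N (leqnn N).
  rewrite /ball /= distrC /u -(subnKC Nn) exprD.
  apply: le_lt_trans (HB _ h1 _) _; rewrite mul1r mulrC.
  rewrite -ltr_pdivlMr//; apply: le_lt_trans h2 _.
  rewrite ltr_pM2l// ltf_pV2 ?posrE ?mulr_gt0//; lra.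
exists (lim (u n @[n --> \oo])); set minf := lim _.
apply/cvgrPdist_le => e e0.
have [B B0 HB] := dbl (e / sg) (divr_gt0 e0 sg0).
near=> t.
have Bt : B <= t by near: t; apply: nbhs_pinfty_ge; exact: num_real.
have t0 : 0 < t by exact: lt_le_trans Bt.
(* The hypothesis at the ratio [x = t], taken along the points [2 ^ n], makes
   [m (2 ^ n * t) - m (2 ^ n)] vanish, so the limit does not depend on the starting point [t]. *)
have mt : m (t * 2 ^+ n) @[n --> \oo] --> minf.
  have h1 : (fun n => (2 ^+ n) `^ rho * ((2 ^+ n) `^ (- rho) * (m (2 ^+ n * t) - m (2 ^+ n))))
      @ \oo --> (0 : R).
    rewrite -[X in _ --> X](mulr0 0); apply: cvgM.
      exact: (cvg_comp _ _ pow2 (powR_pinfty_cvg0 r0)).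
    exact: (cvg_comp _ _ pow2 (H t t0)).
  rewrite (_ : (fun n => m (t * 2 ^+ n)) = (fun n => (2 ^+ n) `^ rho * ((2 ^+ n) `^ (- rho) *
     (m (2 ^+ n * t) - m (2 ^+ n))) + u n)).
    by rewrite -[X in _ --> X]add0r; apply: cvgD.
  apply/funext => n; rewrite powRN mulVKf; last by rewrite gt_eqF// powR_gt0// exprn_gt0.
  by rewrite /u mulrC subrK.
rewrite sub0r normrN normrM powRN ger0_norm ?invr_ge0 ?powR_ge0//.
rewrite mulrC ler_pdivrMr ?powR_gt0// distrC.
have mt' : `|m (t * 2 ^+ n) - m t| @[n --> \oo] --> `|minf - m t|.
  by apply: cvg_norm; apply: cvgB => //; exact: cvg_cst.
rewrite -(cvg_lim _ mt')//; apply: limr_le; first by apply/cvg_ex; eexists; exact: mt'.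
apply: nearW => n; apply: le_trans (HB _ Bt _) _.
by rewrite divfK// gt_eqF.
Unshelve. all: end_near. Qed.

End limits_at_infinity.
Arguments cvgy_cst {R} a [_] _.

(** * From second-order ratios to an expansion of the tail itself *)

Section second_order.
Context {R : realType}.

Lemma expR_sub1_near0 (y : R) : `|y| <= 2^-1 -> `|(expR y - 1) - y| <= 2 * y ^+ 2.
Proof.
move=> /ler_normlP[y1 y2].
have := expR_ge1Dx y; have := expR_ge1Dx (- y).
have : expR (- y) * expR y = 1 by rewrite -expRD addNr expR0.
have := expR_gt0 y.
move: (expR (- y)) (expR y) => a b b0 ab ha hb.
rewrite ger0_norm; last by lra.
have : (1 - y) * b <= 1 by rewrite -[leRHS]ab ler_wpM2r// ltW.
nra.
Qed.

Lemma ln1D_near0 (y : R) : `|y| <= 2^-1 -> `|ln (1 + y) - y| <= 2 * y ^+ 2.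
Proof.
move=> /ler_normlP[y1 y2].
have y0 : 0 < 1 + y by lra.
have := expR_ge1Dx (ln (1 + y)); have := expR_ge1Dx (- ln (1 + y)).
rewrite expRN lnK ?posrE// => h1 h2.
rewrite ler0_norm; last by lra.
have h3 : (1 - ln (1 + y)) * (1 + y) <= 1 by rewrite -ler_pdivlMr// div1r.
move: (ln _) h1 h2 h3 => a h1 h2 h3; nra.
Qed.

(** If [phi] is tangent to the identity at 0, replacing [y t], of order [t ^ rho], by [phi (y t)]
    costs order [t ^ (2 * rho)], which is negligible. The two uses are [ln (1 + z)] and
    [expR z - 1]. *)
Lemma cvg_scaled_tangent (phi y : R -> R) (rho l : R) : rho < 0 ->
  (forall z, `|z| <= 2^-1 -> `|phi z - z| <= 2 * z ^+ 2) ->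
  t `^ (- rho) * y t @[t --> +oo] --> l ->
  t `^ (- rho) * phi (y t) @[t --> +oo] --> l.
Proof.
move=> r0 phiE zl.
have v0 := powR_pinfty_cvg0 r0.
have wv : \forall t \near +oo, 0 < t `^ (- rho) /\ t `^ rho = (t `^ (- rho))^-1.
  near=> t; have t0 : 0 < t by near: t; apply: nbhs_pinfty_gt; exact: num_real.
  by rewrite powRN invrK invr_gt0 powR_gt0.
have y0 : y t @[t --> +oo] --> 0.
  have : t `^ rho * (t `^ (- rho) * y t) @[t --> +oo] --> 0.
    by rewrite -[X in _ --> X](mul0r l); exact: cvgM.
  apply: near_cvg_eq; near=> t; rewrite /=.
  have [w0 ->] : 0 < t `^ (- rho) /\ t `^ rho = (t `^ (- rho))^-1 by near: t.
  by rewrite mulKf// gt_eqF.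
have d0 : t `^ (- rho) * (phi (y t) - y t) @[t --> +oo] --> 0.
  apply/norm_cvg0P.
  have hi : 2 * (t `^ rho * (t `^ (- rho) * y t) ^+ 2) @[t --> +oo] --> 0.
    rewrite -[X in _ --> X](mulr0 2); apply: cvgM; first exact: cvg_cst.
    rewrite -[X in _ --> X](mul0r (l ^+ 2)); apply: cvgM => //.
    by under eq_fun do rewrite expr2; rewrite expr2; exact: cvgM.
  apply: (squeeze_cvgr _ (cvg_cst 0) hi).
  near=> t; rewrite normr_ge0 /=.
  have [w0 ->] : 0 < t `^ (- rho) /\ t `^ rho = (t `^ (- rho))^-1 by near: t.
  have yt : `|phi (y t) - y t| <= 2 * y t ^+ 2.
    apply: phiE; rewrite -[y t]subr0 distrC; near: t.
    by move/cvgrPdist_le : y0; apply.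
  rewrite normrM ger0_norm ?(ltW w0)//.
  apply: le_trans (ler_wpM2l (ltW w0) yt) _.
  by rewrite le_eqVlt; apply/orP; left; apply/eqP; field; rewrite gt_eqF.
have := cvgyD zl d0; rewrite addr0; apply: near_cvg_eq.
by apply: nearW => t /=; rewrite mulrBr addrC subrK.
Unshelve. all: end_near. Qed.

Lemma cvg_of_scaled_cvg (y : R -> R) (rho a l : R) : rho < 0 ->
  t `^ (- rho) * (y t - a) @[t --> +oo] --> l -> y t @[t --> +oo] --> a.
Proof.
move=> rho0 yl.
have := cvgyM (powR_pinfty_cvg0 rho0) yl; rewrite mul0r => h.
have := cvgyD h (cvgy_cst a); rewrite add0r; apply: near_cvg_eq; near=> t.
have t0 : 0 < t by near: t; apply: nbhs_pinfty_gt; exact: num_real.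
by rewrite /= powRN mulVKf ?subrK// gt_eqF// powR_gt0.
Unshelve. all: end_near. Qed.

Lemma powR_cvgy (y : R -> R) (a p : R) : 0 < a ->
  y t @[t --> +oo] --> a -> y t `^ p @[t --> +oo] --> a `^ p.
Proof.
move=> a0 ya; rewrite powRE//.
have h : expR (p * ln (y t)) @[t --> +oo] --> expR (p * ln a).
  apply: continuous_cvg; first exact: continuous_expR.
  apply: cvgyM; first exact: cvgy_cst.
  by apply: continuous_cvg => //; exact: continuous_ln.
apply: near_cvg_eq h; near=> t; rewrite powRE//.
by near: t; exact: (cvgr_gt _ ya).
Unshelve. all: end_near. Qed.

(** Over the denominator [al t * m], the numerator of [be t / al t / m - 1] is
    [(be t - m * a0) - m * (al t - a0)]: the leading terms cancel. *)
Lemma ratio_expansion (al be : R -> R) (rho m a0 a1 b1 : R) : rho < 0 ->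
  a0 != 0 -> m != 0 ->
  t `^ (- rho) * (al t - a0) @[t --> +oo] --> a1 ->
  t `^ (- rho) * (be t - m * a0) @[t --> +oo] --> b1 ->
  t `^ (- rho) * (be t / al t / m - 1) @[t --> +oo] --> (b1 - m * a1) / (a0 * m).
Proof.
move=> rho0 a00 m0 ala beb.
have alim := cvg_of_scaled_cvg rho0 ala.
have am0 : a0 * m != 0 by rewrite mulf_neq0.
have den : (al t * m)^-1 @[t --> +oo] --> (a0 * m)^-1.
  by apply: cvgV => //; apply: cvgyM => //; exact: cvgy_cst.
have := cvgyM (cvgyB beb (cvgyM (cvgy_cst m) ala)) den.
apply: near_cvg_eq; near=> t => /=.
have alt : al t != 0 by near: t; exact: (cvgr_neq0 _ alim).
by field; rewrite alt m0.
Unshelve. all: end_near. Qed.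

(** Logarithms turn the ratios into increments of [ln (t ^ s * S t)] from [t] to [t * x], which are
    [(c / rho) * ((t * x) ^ rho - t ^ rho)] up to [o(t ^ rho)]. Subtracting [(c / rho) * t ^ rho]
    leaves a function to which [cvg_pinfty_shift_limit] applies, and [C] is the exponential of its
    limit. *)
Lemma second_order_tail (S A : R -> R) (s rho c : R) :
  rho < 0 -> c != 0 -> (forall t, 0 <= S t) ->
  t `^ (- rho) * A t @[t --> +oo] --> c ->
  (forall x, 0 < x -> (S (t * x) / S t - x `^ (- s)) / A t @[t --> +oo]
      --> x `^ (- s) * ((x `^ rho - 1) / rho)) ->
  exists2 C, 0 < C &
    t `^ (- rho) * (t `^ s * S t - C) @[t --> +oo] --> C * (c / rho).
Proof.
move=> r0 c0 S0 Ac H.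
have v0 := powR_pinfty_cvg0 r0.
have A0 : \forall t \near +oo, A t != 0.
  have : \forall t \near +oo, t `^ (- rho) * A t != 0 by exact: (cvgr_neq0 _ Ac).
  by apply: filterS => t; rewrite mulf_eq0 negb_or => /andP[].
have rat x : 0 < x ->
    t `^ (- rho) * (x `^ s * (S (t * x) / S t) - 1) @[t --> +oo]
      --> c * ((x `^ rho - 1) / rho).
  move=> x0; have := cvgyM (cvgyM Ac (H x x0)) (cvgy_cst (x `^ s)).
  have xs0 : x `^ s != 0 by rewrite gt_eqF// powR_gt0.
  rewrite (_ : c * _ * _ = c * ((x `^ rho - 1) / rho)); last first.
    by rewrite powRN; field; rewrite xs0 lt_eqF.
  apply: near_cvg_eq; near=> t; rewrite /=.
  have At : A t != 0 by near: t.
  by rewrite [x `^ (- s)]powRN; move: (S (t * x) / S t) => z; field; rewrite xs0 At.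
(* If [S t = 0], division by zero makes the ratio [S (t * 2) / S t] equal to 0, so [2 ^ s] times it
   minus 1 is [-1]; but this quantity tends to 0. *)
have Spos : \forall t \near +oo, 0 < S t.
  have h1 := rat 2 (ltr0Sn _ _).
  have : 2 `^ s * (S (t * 2) / S t) - 1 @[t --> +oo] --> 0.
    have : t `^ rho * (t `^ (- rho) * (2 `^ s * (S (t * 2) / S t) - 1)) @[t --> +oo] --> 0.
      by rewrite -[X in _ --> X](mul0r (c * ((2 `^ rho - 1) / rho))); exact: cvgM.
    apply: near_cvg_eq; near=> t; rewrite /=.
    have t0 : 0 < t by near: t; apply: nbhs_pinfty_gt; exact: num_real.
    by rewrite powRN mulVKf// gt_eqF// powR_gt0.
  move=> /cvgrPdist_lt /(_ 1 ltr01); apply: filterS => t.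
  rewrite sub0r normrN => h; rewrite lt_def S0 andbT; apply/eqP => St.
  by move: h; rewrite St invr0 !mulr0 sub0r normrN normr1 ltxx.
pose m t := ln (t `^ s * S t) - c / rho * t `^ rho.
have [minf mE] : exists minf, t `^ (- rho) * (m t - minf) @[t --> +oo] --> 0.
  apply: cvg_pinfty_shift_limit => // x x0.
  have h1 := cvg_scaled_tangent r0 ln1D_near0 (rat x x0).
  have := cvgyB h1 (cvgy_cst (c * ((x `^ rho - 1) / rho))); rewrite subrr.
  apply: near_cvg_eq; near=> t; rewrite /=.
  have t0 : 0 < t by near: t; apply: nbhs_pinfty_gt; exact: num_real.
  have St : 0 < S t by near: t.
  have Stx : 0 < S (t * x).
    by near: t; exact: (near_pinfty_scale x0 Spos).
  have -> : 1 + (x `^ s * (S (t * x) / S t) - 1) = ((t * x) `^ s * S (t * x)) / (t `^ s * S t).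
    rewrite powRM ?(ltW t0) ?(ltW x0)//; field.
    by rewrite !gt_eqF// powR_gt0.
  rewrite ln_div ?posrE ?mulr_gt0 ?powR_gt0 ?mulr_gt0//.
  rewrite /m [(t * x) `^ rho]powRM ?(ltW t0) ?(ltW x0)// powRN.
  by field; rewrite lt_eqF// gt_eqF// powR_gt0.
exists (expR minf); first exact: expR_gt0.
have h1 : t `^ (- rho) * (ln (t `^ s * S t) - minf) @[t --> +oo] --> c / rho.
  have := cvgyD mE (cvgy_cst (c / rho)); rewrite add0r.
  apply: near_cvg_eq; near=> t; rewrite /=.
  have t0 : 0 < t by near: t; apply: nbhs_pinfty_gt; exact: num_real.
  rewrite /m powRN; field.
  by rewrite (lt_eqF r0) andbT gt_eqF// powR_gt0.
have h2 := cvg_scaled_tangent r0 expR_sub1_near0 h1.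
have := cvgyM (cvgy_cst (expR minf)) h2.
apply: near_cvg_eq; near=> t; rewrite /=.
have t0 : 0 < t by near: t; apply: nbhs_pinfty_gt; exact: num_real.
have St : 0 < S t by near: t.
rewrite /= expRB lnK ?posrE ?mulr_gt0 ?powR_gt0//; field.
by rewrite gt_eqF// expR_gt0.
Unshelve. all: end_near. Qed.

End second_order.

(** * Quantiles *)

Section quantile.
Context {R : realType} {dT : measure_display} {T : measurableType dT}.
Variables (P : probability T R) (Y : T -> R).
Hypothesis mY : measurable_fun setT Y.

Lemma measurable_gt_set (x : R) : measurable [set w | x < Y w].
Proof.
have := @measurable_fun_ltr _ _ R setT (cst x) _ (measurable_cst _) mY.
by move/(_ measurableT [set true]); rewrite setTI; exact.
Qed.

Lemma surv_ge0 (x : R) : 0 <= surv P Y x.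
Proof. by rewrite fine_ge0. Qed.

Lemma surv_nonincreasing (x y : R) : x <= y -> surv P Y y <= surv P Y x.
Proof.
move=> xy; apply: fine_le.
- by apply: fin_num_measure; exact: measurable_gt_set.
- by apply: fin_num_measure; exact: measurable_gt_set.
apply: le_measure; rewrite ?inE; [exact: measurable_gt_set..|].
by move=> w /=; exact: le_lt_trans.
Qed.

Lemma cdf_surv (x : R) : Defs.cdf P Y x = 1 - surv P Y x.
Proof.
rewrite /Defs.cdf /surv (_ : [set w | Y w <= x] = ~` [set w | x < Y w]); last first.
  by apply/seteqP; split=> w /=; rewrite leNgt => /negP.
rewrite probability_setC; last exact: measurable_gt_set.
rewrite fineB//; by apply: fin_num_measure; exact: measurable_gt_set.
Qed.

Lemma UfunE (t : R) : Ufun P Y t = inf [set x | surv P Y x <= t^-1].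
Proof.
congr inf; apply/seteqP; split=> x /=; rewrite cdf_surv; lra.
Qed.

Variables (s a : R).
Hypotheses (s0 : 0 < s) (a0 : 0 < a).
Hypothesis Sa : x `^ s * surv P Y x @[x --> +oo] --> a.

(** At [x = (c * t) ^ (1 / s)] the survival function is close to [a / (c * t)], hence below [1 / t]
    for [c = a + e] and above it for [c = a - e]. Using the tolerance [e / 2] makes the second
    comparison strict, and monotonicity then bounds the infimum from below. *)
Lemma quantile_bounds (e : R) : 0 < e -> e < a ->
  \forall t \near +oo, ((a - e) * t) `^ s^-1 <= Ufun P Y t <= ((a + e) * t) `^ s^-1.
Proof.
move=> e0 ea.
have e20 : 0 < e / 2 by rewrite divr_gt0.
have si0 : 0 < s^-1 by rewrite invr_gt0.
have aDe : 0 < a + e by rewrite addr_gt0.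
have aBe : 0 < a - e by rewrite subr_gt0.
have [B [_ HB]] : \forall x \near +oo, `|a - x `^ s * surv P Y x| <= e / 2.
  by move/cvgrPdist_le : Sa; apply.
near=> t.
have t0 : 0 < t by near: t; apply: nbhs_pinfty_gt; exact: num_real.
have rootK c : 0 < c -> ((c * t) `^ s^-1) `^ s = c * t.
  move=> c0; rewrite -powRrM mulVf ?gt_eqF// powRr1// ltW// mulr_gt0//.
have bnd c : 0 < c -> B < (c * t) `^ s^-1 ->
    `|a - c * t * surv P Y ((c * t) `^ s^-1)| <= e / 2.
  by move=> c0 /HB; rewrite rootK.
have up : surv P Y (((a + e) * t) `^ s^-1) <= t^-1.
  have : B < ((a + e) * t) `^ s^-1.
    apply: (@lt_le_trans _ _ (B + 1)); first by rewrite ltrDl.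
    by near: t; exact: powR_pinfty_ge.
  move/(bnd _ aDe); move: (surv _ _ _) => z /ler_normlP[h1 h2].
  rewrite -div1r ler_pdivlMr// -(ler_pM2l aDe) mulr1; lra.
have low : t^-1 < surv P Y (((a - e) * t) `^ s^-1).
  have : B < ((a - e) * t) `^ s^-1.
    apply: (@lt_le_trans _ _ (B + 1)); first by rewrite ltrDl.
    by near: t; exact: powR_pinfty_ge.
  move/(bnd _ aBe); move: (surv _ _ _) => z /ler_normlP[h1 h2].
  rewrite -div1r ltr_pdivrMr// -(ltr_pM2l aBe) mulr1; lra.
have lb : lbound [set x | surv P Y x <= t^-1] (((a - e) * t) `^ s^-1).
  move=> x /= xt; rewrite leNgt; apply/negP => /ltW/surv_nonincreasing h.
  by have := lt_le_trans low (le_trans h xt); rewrite ltxx.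
rewrite UfunE; apply/andP; split.
  by apply: lb_le_inf => //; exists (((a + e) * t) `^ s^-1).
by apply: ge_inf => //; eexists; exact: lb.
Unshelve. all: end_near. Qed.

Lemma quantile_pinfty : Ufun P Y t @[t --> +oo] --> +oo.
Proof.
apply/cvgryPge => B.
have a2 : 0 < a / 2 by rewrite divr_gt0.
have a2a : a / 2 < a by lra.
have aB : 0 < a - a / 2 by lra.
have si0 : 0 < s^-1 by rewrite invr_gt0.
near=> t.
have : ((a - a / 2) * t) `^ s^-1 <= Ufun P Y t <= ((a + a / 2) * t) `^ s^-1.
  by near: t; exact: quantile_bounds.
move=> /andP[+ _]; apply: le_trans.
by near: t; exact: powR_pinfty_ge.
Unshelve. all: end_near. Qed.

Lemma quantile_powR_cvg : Ufun P Y t `^ s / t @[t --> +oo] --> a.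
Proof.
apply/cvgrPdist_le => e e0.
pose e' := Num.min e (a / 2).
have e'0 : 0 < e' by rewrite lt_min e0 divr_gt0.
have e'a : e' < a by rewrite gt_min; apply/orP; right; rewrite ltr_pdivrMr//; move: a0; lra.
near=> t.
have t0 : 0 < t by near: t; apply: nbhs_pinfty_gt; exact: num_real.
have : ((a - e') * t) `^ s^-1 <= Ufun P Y t <= ((a + e') * t) `^ s^-1.
  by near: t; exact: quantile_bounds.
have rootK c : 0 < c -> ((c * t) `^ s^-1) `^ s = c * t.
  by move=> c0; rewrite -powRrM mulVf ?gt_eqF// powRr1// ltW// mulr_gt0.
move=> /andP[h1 h2].
have U0 : 0 <= Ufun P Y t by apply: le_trans h1; exact: powR_ge0.
have {}h1 : (a - e') * t <= Ufun P Y t `^ s.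
  rewrite -rootK ?subr_gt0// ge0_ler_powR ?nnegrE ?powR_ge0 ?(ltW s0)//.
have {}h2 : Ufun P Y t `^ s <= (a + e') * t.
  rewrite -rootK ?addr_gt0// ge0_ler_powR ?nnegrE ?powR_ge0 ?(ltW s0)//.
have ee : e' <= e by rewrite ge_min lexx.
rewrite -ler_pdivlMr// in h1; rewrite -ler_pdivrMr// in h2.
rewrite ler_norml; apply/andP; split; lra.
Unshelve. all: end_near. Qed.

End quantile.

(** * Expansion of the density, and tail means *)

Section density_expansion.
Context {R : realType} (d : nat).
Implicit Types (w x : d.-tuple R).

Definition normalize x : d.-tuple R := tscale (l1 x)^-1 x.

Lemma normalize_simplex x : tail 0 x -> simplex d (normalize x).
Proof.
move=> [x0 lx]; split; last by rewrite l1_tscale mulVf// gt_eqF.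
by move=> i; rewrite tnth_map mulr_ge0// invr_ge0 ltW.
Qed.

Lemma tscale_normalize x : 0 < l1 x -> tscale (l1 x) (normalize x) = x.
Proof. by move=> lx; rewrite tscaleA mulfV ?tscale1// gt_eqF. Qed.

Lemma normalize_tscale (c : R) x : 0 < c -> normalize (tscale c x) = normalize x.
Proof.
move=> c0; rewrite /normalize tscaleA l1_tscale invfM.
by congr tscale; rewrite mulrAC mulVf ?mul1r// gt_eqF.
Qed.

Lemma measurable_simplex : measurable (simplex d : set (d.-tuple R)).
Proof.
rewrite (_ : simplex d = [set x : d.-tuple R | forall i, 0 <= tnth x i] `&`
   (@l1 R d) @^-1` [set 1])//.
apply: measurableI; first exact: measurable_nonneg_tuple.
by rewrite -[X in measurable X]setTI; apply: measurable_l1.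
Qed.

Lemma measurable_normalize (u : R) : 0 <= u -> measurable_fun (tail u) normalize.
Proof.
move=> u0; apply: (@eq_measurable_fun _ _ _ _ _
    (fun x => tscale (l1 x `^ (-1)) x : d.-tuple R)).
  move=> x; rewrite inE => -[_ lx]; rewrite /normalize powR_inv1//.
  by rewrite ltW// (le_lt_trans u0).
apply: measurable_funTS; apply/measurable_fun_tnthP => i.
rewrite (_ : _ \o _ = fun x => l1 x `^ (-1) * tnth x i); last first.
  by apply/funext => x /=; rewrite tnth_map.
by apply: measurable_funM; [exact: measurable_l1_powR|exact: measurable_tnth].
Qed.

Lemma measurable_comp_normalize (u : R) (psi : d.-tuple R -> R) : 0 <= u ->
  measurable_fun (simplex d) psi -> measurable_fun (tail u) (psi \o normalize).
Proof.
move=> u0 mpsi; apply: (measurable_comp measurable_simplex) => //.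
  by move=> _ [x /(tailS u0) tx <-]; exact: normalize_simplex.
exact: measurable_normalize.
Qed.

Variables (f q lam : d.-tuple R -> R) (S A : R -> R) (s rho c C M : R).
Hypotheses (rho0 : rho < 0) (c0 : c != 0) (C0 : 0 < C) (M0 : 0 <= M).
Hypothesis Slim : t `^ (- rho) * (t `^ s * S t - C) @[t --> +oo] --> C * (c / rho).
Hypothesis Alim : t `^ (- rho) * A t @[t --> +oo] --> c.
Hypothesis qM : forall w, simplex d w -> `|q w| <= M.
Hypothesis lamM : forall w, simplex d w -> `|lam w| <= M.
Hypothesis flim : forall e, 0 < e -> exists B, forall t, B <= t -> forall w, simplex d w ->
  `| (t ^+ d * f (tscale t w) / S t - q w) / A t - lam w | <= e.

(** Multiply the density ratio [q + A t * (lam + o(1))] by [t ^ s * S t]: the second-order term of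
    [S] contributes [C * c * q / rho], and [A t], of order [c * t ^ rho], contributes
    [C * c * lam]. *)
Lemma density_expansion_simplex (e : R) : 0 < e ->
  exists B, forall t, B <= t -> forall w, simplex d w ->
  `|t `^ (d%:R + s) * f (tscale t w) - C * q w - t `^ rho * (C * c * (q w / rho + lam w))|
   <= e * t `^ rho.
Proof.
(* [K] adds the coefficients of the three errors below: [M] for [eta * q], [M] for [zeta * lam], and
   the rest for [(C * c - zeta) * eps], where [dl <= 1] bounds [zeta]. *)
move=> e0; pose K := 2 * M + 1 + `|C * c|.
have K0 : 0 < K by rewrite /K; have := normr_ge0 (C * c); move: M0; lra.
pose dl := Num.min 1 (e / K).
have dl0 : 0 < dl by rewrite lt_min ltr01 divr_gt0.
have dl1 : dl <= 1 by rewrite ge_min lexx.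
have dlK : dl * K <= e by rewrite -ler_pdivlMr// ge_min lexx orbT.
have bC := cvg_of_scaled_cvg rho0 Slim.
have zlim : t `^ s * S t * (t `^ (- rho) * A t) @[t --> +oo] --> C * c by exact: cvgyM.
have [B1 HB1] := flim dl0.
apply: near_pinfty_ex; near=> t => w Sw.
have t0 : 0 < t by near: t; apply: nbhs_pinfty_gt; exact: num_real.
have Bt : B1 <= t by near: t; apply: nbhs_pinfty_ge; exact: num_real.
have eta1 : `|C * (c / rho) - t `^ (- rho) * (t `^ s * S t - C)| <= dl.
  by near: t; move/cvgrPdist_le : Slim; apply.
have zeta1 : `|C * c - t `^ s * S t * (t `^ (- rho) * A t)| <= dl.
  by near: t; move/cvgrPdist_le : zlim; apply.
have St : S t != 0.
  have : t `^ s * S t != 0 by near: t; apply: (cvgr_neq0 _ bC); rewrite gt_eqF.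
  by rewrite mulf_eq0 negb_or => /andP[].
have At : A t != 0.
  have : t `^ (- rho) * A t != 0 by near: t; exact: (cvgr_neq0 _ Alim).
  by rewrite mulf_eq0 negb_or => /andP[].
have eps1 := HB1 t Bt w Sw.
have v0 : 0 < t `^ rho by exact: powR_gt0.
have q1 := qM Sw; have l1 := lamM Sw.
set eta := _ - _ in eta1; set zeta := _ - _ in zeta1; set eps := _ - _ in eps1.
have -> : t `^ (d%:R + s) * f (tscale t w) - C * q w -
    t `^ rho * (C * c * (q w / rho + lam w)) =
    t `^ rho * (- eta * q w - zeta * lam w + (C * c - zeta) * eps).
  rewrite /eta /zeta /eps powRD ?(gt_eqF t0) ?implybT// powR_mulrn ?(ltW t0)// powRN.
  by field; rewrite St At (lt_eqF rho0) (gt_eqF v0).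
rewrite normrM ger0_norm ?(ltW v0)// mulrC ler_wpM2r ?(ltW v0)//.
apply: le_trans dlK.
apply: le_trans (ler_normD _ _) _.
apply: le_trans (lerD (ler_normB _ _) (lexx _)) _.
rewrite !normrM normrN.
have h1 : `|eta| * `|q w| <= dl * M by exact: ler_pM.
have h2 : `|zeta| * `|lam w| <= dl * M by exact: ler_pM.
have h3 : `|C * c - zeta| * `|eps| <= (`|C * c| + 1) * dl.
  apply: ler_pM => //; apply: le_trans (ler_normB _ _) _.
  by rewrite lerD2l (le_trans zeta1).
rewrite /K; lra.
Unshelve. all: end_near. Qed.

(** The simplex expansion is applied at [t = u * l1 x] in the direction [normalize x]. Since
    [t >= u] on [tail 1], one threshold serves all [x], and the powers of [l1 x] are split off from
    those of [t]. *)
Lemma density_expansion_tail (e : R) : 0 < e -> exists B, forall u, B <= u -> forall x, tail 1 x ->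
  `|u `^ (d%:R + s) * f (tscale u x) - l1 x `^ (- (d%:R + s)) * (C * q (normalize x)) -
    u `^ rho * (l1 x `^ (- (d%:R + s)) * l1 x `^ rho *
      (C * c * (q (normalize x) / rho + lam (normalize x))))|
  <= e * (u `^ rho * (l1 x `^ (- (d%:R + s)) * l1 x `^ rho)).
Proof.
move=> e0; have [B HB] := density_expansion_simplex e0.
exists (Num.max B 1) => u; rewrite ge_max => /andP[Bu u1] x Tx.
have lx1 : 1 < l1 x by case: Tx.
have lx0 : 0 < l1 x by exact: lt_trans lx1.
have u0 : 0 < u by exact: lt_le_trans u1.
have /HB/(_ _ (normalize_simplex (tailS ler01 Tx))) : B <= u * l1 x.
  by apply: le_trans Bu _; rewrite ler_peMr// ltW.
rewrite -tscaleA tscale_normalize// !powRM ?(ltW u0) ?(ltW lx0)// => h.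
have p0 : 0 < l1 x `^ (d%:R + s) by exact: powR_gt0.
rewrite powRN.
move: h p0; move: (l1 x `^ (d%:R + s)) => p h p0.
rewrite -(ler_pM2l p0) -[X in X * _](ger0_norm (ltW p0)) -normrM.
have pn : p != 0 by rewrite gt_eqF.
rewrite (_ : p * (e * _) = e * (u `^ rho * l1 x `^ rho)); last by field.
apply: le_trans h; rewrite le_eqVlt; apply/orP; left; apply/eqP; congr `|_|.
by field; rewrite pn lt_eqF.
Qed.

End density_expansion.

Section tail_means.
Context {R : realType} (d : nat) {dT : measure_display} {T : measurableType dT}.
Variables (P : probability T R) (X : T -> d.-tuple R) (f : d.-tuple R -> R).
Variable mu : {measure set (d.-tuple R) -> \bar R}.
Hypothesis muP : tuple_lebesgue_spec mu.
Hypotheses (mX : measurable_fun setT X)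
  (X0 : P [set w | forall i, 0 <= tnth (X w) i] = 1%E).
Hypotheses (mf : measurable_fun setT f) (f0 : forall x, 0 <= f x).
Hypothesis fX : forall B, measurable B ->
  P (X @^-1` B) = lebint (fun x => (f x * \1_B x)%:E).

Let pos := [set w | forall i, 0 <= tnth (X w) i].

Let mpos : measurable pos.
Proof.
have := mX measurableT (@measurable_nonneg_tuple R d).
by rewrite setTI.
Qed.

Let Ppos : P (~` pos) = 0%E.
Proof. by rewrite probability_setC// X0 subee. Qed.

Lemma integral_density (g : d.-tuple R -> \bar R) : measurable_fun setT g ->
  (forall x, 0 <= g x)%E ->
  (\int[P]_w g (X w) = \int[mu]_x (g x * (f x)%:E))%E.
Proof.
move=> mg g0; rewrite -(ge0_integral_image P mX)//.
apply: ge0_integral_density => //; first exact/measurable_EFinP.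
move=> B mB; case: muP => _ muint _.
transitivity (P (X @^-1` B)); first by [].
rewrite fX// muint.
- rewrite integral_mkcond; apply: eq_integral => x _.
  by rewrite epatch_indic EFinM.
- by apply/measurable_EFinP; apply: measurable_funM.
- by move=> x; rewrite lee_fin mulr_ge0.
Qed.

Section tail_mean.
Variables (u : R) (phi : d.-tuple R -> R).
Hypotheses (u0 : 0 <= u) (mphi : measurable_fun setT phi).
Hypothesis phi0 : forall x, tail 0 x -> 0 <= phi x.

Let psi (x : d.-tuple R) : \bar R := (phi x * \1_(tail u) x)%:E.

Let mpsi : measurable_fun setT psi.
Proof.
apply/measurable_EFinP; apply: measurable_funM => //.
by apply: measurable_indic; exact: measurable_tail.
Qed.

Let psi0 x : (0 <= psi x)%E.
Proof.
rewrite lee_fin indicE; case: (boolP (x \in tail u)); last by rewrite mulr0.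
by rewrite inE mulr1 => /(tailS u0)/phi0.
Qed.

Let psiE : (\int[P]_w psi (X w) = \int[mu]_(x in tail u) (phi x * f x)%:E)%E.
Proof.
rewrite integral_density// [RHS]integral_mkcond; apply: eq_integral => x _.
by rewrite epatch_indic /psi -!EFinM mulrAC.
Qed.

(** The vector is nonnegative only almost surely, so the event on [l1 (X w)] and the preimage of
    [tail u] coincide up to a null set. *)
Lemma tail_mean : (\int[P]_(w in [set w | u < l1 (X w)]%R) (phi (X w))%:E =
  \int[mu]_(x in tail u) (phi x * f x)%:E)%E.
Proof.
have mD : measurable [set w | u < l1 (X w)].
  apply: (@measurable_gt_set _ _ _ (fun w => l1 (X w))).
  by apply: measurableT_comp => //; exact: measurable_l1.
have mphiX : measurable_fun setT (fun w => (phi (X w))%:E).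
  by apply/measurable_EFinP; exact: measurableT_comp.
rewrite -psiE integral_mkcond; apply: ae_eq_integral => //.
- by apply/(measurable_restrictT _ mD); exact: measurable_funTS.
- exact: measurableT_comp.
exists (~` pos); split=> //; first exact: measurableC.
move=> w; apply: contra_not => wpos _.
rewrite epatch_indic /psi -EFinM; congr (_ * _)%:E.
rewrite !indicE; congr (_%:R); congr (nat_of_bool _).
apply/idP/idP; rewrite !inE => H; first by split.
by case: H.
Qed.

(** For nonnegative vectors, a coordinate above [u] puts the vector in [tail u]. The cases [phi = 1]
    with [K = 1] and [phi x = tnth x j] with [K = u] give the lower bounds on the two leading
    constants. *)
Lemma surv_le_tail_mean (j : 'I_d) (K : R) : 0 <= K ->
  (forall x, tail 0 x -> u < tnth x j -> K <= phi x) ->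
  (K%:E * P [set w | u < tnth (X w) j]%R <=
    \int[mu]_(x in tail u) (phi x * f x)%:E)%E.
Proof.
move=> K0 Kphi; rewrite -psiE.
set B := [set w | _].
have mB : measurable B.
  apply: (@measurable_gt_set _ _ _ (fun w => tnth (X w) j)).
  apply: (@measurableT_comp _ _ _ _ _ _ (fun x : d.-tuple R => tnth x j)) => //.
  exact: measurable_tnth.
have -> : P B = P (B `&` pos).
  rewrite (measureDI P mB mpos) [X in (X + _)%E](_ : _ = 0%E) ?add0e//.
  apply: (subset_measure0 _ _ _ Ppos) => //; first exact: measurableD.
    exact: measurableC.
have mBp : measurable (B `&` pos) by exact: measurableI.
rewrite -(@integral_cst _ _ _ P _ mBp K%:E).
rewrite integral_mkcond; apply: ge0_le_integral => //.
- by move=> w _; rewrite erestrict_ge0// => *; rewrite lee_fin.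
- by apply/(measurable_restrictT _ mBp); exact: measurable_cst.
- exact: measurableT_comp.
move=> w _; rewrite patchE; case: ifPn => // /[!inE] -[/= Bw posw].
have l1w : u < l1 (X w).
  by apply: lt_le_trans Bw _; rewrite /l1 (bigD1 j)//= lerDl sumr_ge0.
have tw : tail u (X w) by [].
rewrite /psi indicE mem_set// mulr1 lee_fin Kphi//.
exact: (tailS u0 tw).
Qed.

End tail_mean.
End tail_means.

(** * The relative error of the tail mean at a quantile *)

Theorem theorem1 (R : realType) (d : nat) (dT : measure_display)
  (T : measurableType dT) (P : probability T R)
  (X : T -> d.-tuple R) (gamma : R)
  (f : d.-tuple R -> R)
  (H : probability (d.-tuple R) R) (h : d.-tuple R -> R)
  (rho : R) (A : 'I_d -> R -> R) (lam : 'I_d -> d.-tuple R -> R)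
  (q : 'I_d -> d.-tuple R -> R) :
  let Xc (j : 'I_d) := fun w : T => tnth (X w) j in
  let Rs := fun w : T => l1 (X w) in
  let W := fun w : T => tscale (l1 (X w))^-1 (X w) in
  let theta (j : 'I_d) (tau : R) := cond_mean P (Xc j) [set w | Qfun P Rs tau < Rs w] in
  let wbar (j : 'I_d) := fine (\int[H]_v (tnth v j)%:E)%E in
  (0 < d)%N ->
  (* X is a random vector on [0,oo)^d *)
  measurable_fun setT X ->
  P [set w | forall i, 0 <= tnth (X w) i] = 1%E ->
  (* gamma in (0,1) *)
  0 < gamma < 1 ->
  (* F has a density f *)
  measurable_fun setT f -> (forall x, 0 <= f x) ->
  (forall B, measurable B ->
     P (X @^-1` B) = lebint (fun x => ((f x) * \1_B x)%:E)) ->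
  (* F in RV(1/gamma): P(R > x) regularly varying with index -1/gamma ... *)
  (forall x : R, 0 < x ->
     surv P Rs (t * x) / surv P Rs t @[t --> +oo] --> x `^ (- gamma^-1)) ->
  (* ... and P(W in . | R > t) -> H weakly *)
  (forall g : d.-tuple R -> R, measurable_fun setT g ->
     bounded_on (simplex d) g -> cont_on (simplex d) g ->
     cond_mean P (fun w => g (W w)) [set w | t < Rs w] @[t --> +oo]
       --> fine (\int[H]_v (g v)%:E)%E) ->
  (* H has a bounded continuous density h : S -> (0,oo) *)
  (forall w, simplex d w -> 0 < h w) ->
  bounded_on (simplex d) h -> cont_on (simplex d) h ->
  measurable_fun (simplex d) h ->
  (forall B, measurable B ->
     H B = simplex_int (fun w => (h w * \1_B w)%:E)) ->
  (* uniform convergence of the rescaled density *)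
  (forall e : R, 0 < e -> exists M : R, forall t, M <= t -> forall w, simplex d w ->
     `| t ^+ d * f (tscale t w) / surv P Rs t - h w / gamma | <= e) ->
  (* Condition 1 *)
  rho < 0 ->
  (forall j, exists2 c : R, c != 0 & t `^ (- rho) * A j t @[t --> +oo] --> c) ->
  (forall j (x : R), 0 < x ->
     (surv P (Xc j) (t * x) / surv P (Xc j) t - x `^ (- gamma^-1)) / A j t
       @[t --> +oo] --> x `^ (- gamma^-1) * ((x `^ rho - 1) / rho)) ->
  (forall j, measurable_fun setT (lam j)) ->
  (forall j, exists2 x, orthant d x & lam j x != 0) ->
  (forall j (e : R), 0 < e ->
     (lebint (fun x => (`|lam j x| * \1_(orthant d `&` [set y | e < l1 y]) x)%:E)
       < +oo)%E) ->
  (forall j, bounded_on (simplex d) (lam j)) ->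
  (forall j, exists c : R, forall x, orthant0 d x ->
     q j x = c * (l1 x `^ (- d%:R - gamma^-1)) * h (tscale (l1 x)^-1 x)) ->
  (forall j x, orthant d x ->
     (t ^+ d * f (tscale t x) / surv P (Xc j) t - q j x) / A j t
       @[t --> +oo] --> lam j x) ->
  (forall j (e : R), 0 < e -> exists M : R, forall t, M <= t -> forall w, simplex d w ->
     `| (t ^+ d * f (tscale t w) / surv P (Xc j) t - q j w) / A j t - lam j w | <= e) ->
  (* conclusion *)
  forall j : 'I_d, exists c : R,
    (A j (Ufun P (Xc j) t))^-1 *
      (theta j (1 - t^-1) / (Qfun P Rs (1 - t^-1) * wbar j / (1 - gamma)) - 1)
      @[t --> +oo] --> c.
Proof.
move=> Xc Rs W theta wbar d0 mX X0 /andP[g0 g1] mf f0 fX _ Wcv hpos [Mh hM] _ mh _ _.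
move=> rho0 Acv Sj mlam _ _ lamb qE _ fju j.
have [c c0 Ac] := Acv j.
have [Ml lamM] := lamb j.
have [cq qEj] := qE j.
have [mu muP] := @tuple_lebesgue_exists R d.
pose s := gamma^-1.
have s1 : 1 < s by rewrite invf_gt1.
have s0 : 0 < s by exact: lt_trans s1.
have mXj : measurable_fun setT (Xc j).
  apply: (@measurableT_comp _ _ _ _ _ _ (fun x : d.-tuple R => tnth x j)) => //.
  exact: measurable_tnth.
have mRs : measurable_fun setT Rs by apply: measurableT_comp => //; exact: measurable_l1.
have [C C0 Slim] := second_order_tail rho0 c0 (surv_ge0 P (Xc j)) Ac (Sj j).
have qh w : simplex d w -> q j w = cq * h w.
  move=> [w0 w1]; rewrite qEj; last by split=> //; rewrite w1.
  by rewrite w1 powR1 mulr1 invr1 tscale1.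
pose M := `|cq| * `|Mh| + `|Ml|.
have M0 : 0 <= M by rewrite addr_ge0// mulr_ge0.
have qM w : simplex d w -> `|q j w| <= M.
  move=> Sw; rewrite qh// normrM -[leLHS]addr0 lerD//.
  by rewrite ler_wpM2l// (le_trans (hM _ Sw))// ler_norm.
have lamM' w : simplex d w -> `|lam j w| <= M.
  move=> Sw; rewrite -[leLHS]add0r lerD ?mulr_ge0//.
  by rewrite (le_trans (lamM _ Sw))// ler_norm.
have fE := density_expansion_tail rho0 c0 C0 M0 Slim Ac qM lamM' (fju j).
pose Phi x := C * q j (normalize x).
pose Psi x := C * c * (q j (normalize x) / rho + lam j (normalize x)).
pose M2 := C * M + `|C * c| * (M / `|rho| + M).
have T10 (x : d.-tuple R) : tail 1 x -> tail (0 : R) x by exact: tailS.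
have PhiM x : tail 1 x -> `|Phi x| <= M2.
  move=> /T10/normalize_simplex Sx; rewrite normrM (ger0_norm (ltW C0)).
  rewrite -[leLHS]addr0 lerD//; first by rewrite ler_pM2l// qM.
  by rewrite mulr_ge0// addr_ge0// divr_ge0.
have PsiM x : tail 1 x -> `|Psi x| <= M2.
  move=> /T10/normalize_simplex Sx; rewrite normrM.
  rewrite -[leLHS]add0r lerD ?mulr_ge0 ?(ltW C0)// ler_wpM2l//.
  apply: le_trans (ler_normD _ _) _; rewrite lerD ?lamM'// normrM normfV.
  by rewrite ler_wpM2r ?invr_ge0// qM.
have mhn : measurable_fun (tail 1) (h \o @normalize R d).
  exact: measurable_comp_normalize.
have mqn : measurable_fun (tail 1) (fun x => q j (normalize x)).
  apply: (@eq_measurable_fun _ _ _ _ _ (fun x => cq * (h \o @normalize R d) x)).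
    by move=> x; rewrite inE => /T10/normalize_simplex Sx; rewrite /= qh.
  exact: measurable_funM.
have mPhi : measurable_fun (tail 1) Phi by exact: measurable_funM.
have mPsi : measurable_fun (tail 1) Psi.
  apply: measurable_funM => //; apply: measurable_funD; first exact: measurable_funM.
  by apply: measurable_comp_normalize => //; exact: measurable_funTS.
pose Pw (x : d.-tuple R) := l1 x `^ (- (d%:R + s)).
pose G g u := fine (\int[mu]_(x in tail u) (g x * f x)%:E)%E.
pose I0 g := \int[mu]_(x in tail 1) (g x * (Pw x * Phi x)).
pose I1 g := \int[mu]_(x in tail 1) (g x * (Pw x * (l1 x `^ rho * Psi x))).
have expansion (g : d.-tuple R -> R) k : k < s -> measurable_fun setT g ->
    (forall x, tail 0 x -> 0 <= g x <= l1 x `^ k) ->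
    (forall c x, 0 < c -> tail 0 x -> g (tscale c x) = c `^ k * g x) ->
    u `^ (- rho) * (u `^ (s - k) * G g u - I0 g) @[u --> +oo] --> I1 g.
  move=> ks mg gb gh.
  exact: (tail_integral_expansion muP rho0 ks mf f0 mg gb gh mPhi mPsi PhiM PsiM fE).
(* The three weights, of degrees 0, 1 and 0, produce [P(R > u)], [E(X_j; R > u)] and
   [E(W_j; R > u)]; the last one identifies [wbar j]. In [gW] the power [-1] of [l1 x] is measurable
   everywhere and equals the inverse on [tail 0]. *)
pose gone (x : d.-tuple R) : R := 1.
pose gj (x : d.-tuple R) := tnth x j.
pose gW (x : d.-tuple R) := l1 x `^ (-1) * tnth x j.
have mgj : measurable_fun setT gj by exact: measurable_tnth.
have mgW : measurable_fun setT gW.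
  by apply: measurable_funM => //; exact: measurable_l1_powR.
have mg1 : measurable_fun setT gone by exact: measurable_cst.
have xj_le (x : d.-tuple R) : tail 0 x -> 0 <= tnth x j <= l1 x.
  by move=> [x0 _]; rewrite x0 /= /l1 (bigD1 j)//= lerDl sumr_ge0.
have gW_bnd (x : d.-tuple R) : tail 0 x -> 0 <= gW x <= l1 x `^ 0.
  move=> tx; have /andP[h1 h2] := xj_le x tx; have [_ lx] := tx.
  rewrite powRr0 /gW powR_inv1 ?(ltW lx)// mulr_ge0 ?invr_ge0 ?(ltW lx)//=.
  by rewrite mulrC ler_pdivrMr// mul1r.
have gj_bnd (x : d.-tuple R) : tail 0 x -> 0 <= gj x <= l1 x `^ 1.
  by move=> tx; rewrite powRr1 ?xj_le//; case: tx => _ /ltW.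
have g1_bnd (x : d.-tuple R) : tail 0 x -> 0 <= gone x <= l1 x `^ 0.
  by move=> _; rewrite powRr0 ler01 lexx.
have gW_hom c' x : 0 < c' -> tail 0 x -> gW (tscale c' x) = c' `^ 0 * gW x.
  move=> c'0 [_ lx]; rewrite /gW tnth_map l1_tscale powRr0 mul1r powRM ?(ltW c'0) ?(ltW lx)//.
  by rewrite (powR_inv1 (ltW c'0)) mulrACA mulVf ?mul1r// gt_eqF.
have gj_hom c' x : 0 < c' -> tail 0 x -> gj (tscale c' x) = c' `^ 1 * gj x.
  by move=> c'0 _; rewrite /gj tnth_map powRr1// ltW.
have g1_hom c' x : 0 < c' -> tail 0 x -> gone (tscale c' x) = c' `^ 0 * gone x.
  by move=> _ _; rewrite powRr0 mulr1.
have E1 := @expansion gone 0 s0 mg1 g1_bnd g1_hom.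
have Ej := @expansion gj 1 s1 mgj gj_bnd gj_hom.
have EW := @expansion gW 0 s0 mgW gW_bnd gW_hom.
have Fj := tail_integral_lty muP rho0 s1 mf f0 mgj gj_bnd gj_hom mPhi PhiM PsiM fE.
rewrite /= subr0 in E1 EW.
have L1 := cvg_of_scaled_cvg rho0 E1.
have Lj := cvg_of_scaled_cvg rho0 Ej.
have LW := cvg_of_scaled_cvg rho0 EW.
have LS := cvg_of_scaled_cvg rho0 Slim.
have g_ge0 g k : (forall x, tail 0 x -> 0 <= g x <= l1 x `^ k) ->
    forall x : d.-tuple R, tail 0 x -> 0 <= g x.
  by move=> gb x /gb/andP[].
have P1 u : 0 <= u ->
    (P [set w | u < Rs w]%R = \int[mu]_(x in tail u) (gone x * f x)%:E)%E.
  move=> u0; rewrite -(tail_mean muP mX X0 mf f0 fX u0 mg1 (g_ge0 _ _ g1_bnd)).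
  by rewrite (eq_integral (cst 1%E))// integral_cst ?mul1e//; exact: measurable_gt_set.
have survR u : 0 <= u -> surv P Rs u = G gone u by move=> u0; rewrite /surv P1.
have numj u : 0 <= u ->
    fine (\int[P]_(w in [set w | u < Rs w]%R) (Xc j w)%:E)%E = G gj u.
  move=> u0; congr fine.
  exact: (tail_mean muP mX X0 mf f0 fX u0 mgj (g_ge0 _ _ gj_bnd)).
have numW u : 0 <= u ->
    fine (\int[P]_(w in [set w | u < Rs w]%R) (gj (W w))%:E)%E = G gW u.
  move=> u0; congr fine.
  rewrite -(tail_mean muP mX X0 mf f0 fX u0 mgW (g_ge0 _ _ gW_bnd)).
  apply: eq_integral => w; rewrite inE /= => uw; congr EFin.
  by rewrite /gj /W /gW tnth_map powR_inv1// ltW// (le_lt_trans u0).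
have Ca0 : C <= I0 gone.
  apply: (ler_cvg_to LS L1); near=> u.
  have u0 : 0 < u by near: u; apply: nbhs_pinfty_gt; exact: num_real.
  rewrite ler_wpM2l ?powR_ge0// -survR ?(ltW u0)//.
  apply: fine_le; try by apply: fin_num_measure; exact: measurable_gt_set.
  rewrite (P1 _ (ltW u0)) -[leLHS]mul1e.
  exact: (surv_le_tail_mean muP mX X0 mf f0 fX (ltW u0) mg1 (g_ge0 _ _ g1_bnd)).
have Cb0 : C <= I0 gj.
  apply: (ler_cvg_to LS Lj); near=> u.
  have u0 : 0 < u by near: u; apply: nbhs_pinfty_gt; exact: num_real.
  have Fu : (\int[mu]_(x in tail u) (gj x * f x)%:E < +oo)%E by near: u; exact: Fj.
  have -> : u `^ s = u `^ (s - 1) * u.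
    by rewrite -{3}(powRr1 (ltW u0)) -powRD ?subrK// (gt_eqF u0) implybT.
  rewrite -mulrA ler_wpM2l ?powR_ge0//.
  have Pfin : P [set w | u < Xc j w] \is a fin_num.
    by apply: fin_num_measure; exact: measurable_gt_set.
  rewrite -lee_fin EFinM /surv fineK// /G fineK; last first.
    rewrite ge0_fin_numE//; apply: integral_ge0 => x /(tailS (ltW u0))/gj_bnd/andP[? _].
    by rewrite lee_fin mulr_ge0.
  apply: (surv_le_tail_mean muP mX X0 mf f0 fX (ltW u0) mgj (g_ge0 _ _ gj_bnd)).
    exact: ltW.
  by move=> x _ /ltW.
have a00 : 0 < I0 gone by exact: lt_le_trans Ca0.
have b00 : 0 < I0 gj by exact: lt_le_trans Cb0.
(* The coordinate is bounded and continuous on the simplex, so weak convergence gives one limit of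
   the conditional mean of [W_j]; the two expansions give another, and limits are unique. *)
have wbarE : wbar j = I0 gW / I0 gone.
  have hW : cond_mean P (fun w => gj (W w)) [set w | t < Rs w] @[t --> +oo] --> wbar j.
    apply: Wcv => //.
    - exists 1 => w [w0 w1]; rewrite /gj ger0_norm ?w0// -[leRHS]w1 /l1 (bigD1 j)//= lerDl.
      by rewrite sumr_ge0.
    - by move=> w Sw e e0; exists e => // v Sv /(_ j).
  have h2 : (t `^ s * G gW t) / (t `^ s * G gone t) @[t --> +oo] --> I0 gW / I0 gone.
    by apply: cvgyM => //; apply: cvgV => //; rewrite gt_eqF.
  have h3 : cond_mean P (fun w => gj (W w)) [set w | t < Rs w] @[t --> +oo]
      --> I0 gW / I0 gone.
    apply: near_cvg_eq h2; near=> t.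
    have t0 : 0 < t by near: t; apply: nbhs_pinfty_gt; exact: num_real.
    have ts : t `^ s != 0 by rewrite gt_eqF// powR_gt0.
    rewrite /cond_mean (numW _ (ltW t0)) (P1 _ (ltW t0)) -/(G gone t).
    by rewrite -mulf_div mulfV// mul1r.
  exact: (cvg_unique _ hW h3).
have b0E : I0 gj = wbar j / (1 - gamma) * I0 gone.
  have b0J : (s - 1) * I0 gj = s * I0 gW.
    (* A common angular factor: [tnth x j] is [l1 x] times [gW x], so [I0 gj] and [I0 gW] are
       [C * cq] times the integrals of [phi] with indices [s - 1] and [s]. *)
    pose phi x := gW x * (h \o @normalize R d) x.
    have mphi : measurable_fun (tail 1) phi.
      by apply: measurable_funM => //; exact: measurable_funTS.
    have phi0M x : tail 1 x -> 0 <= phi x <= `|Mh|.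
      move=> Tx; have Sx := normalize_simplex (T10 x Tx).
      have /andP[w0 w1] := gW_bnd x (T10 x Tx); rewrite powRr0 in w1.
      have h0 := hpos _ Sx; rewrite mulr_ge0 ?(ltW h0)//=.
      apply: (@le_trans _ _ (1 * h (normalize x))); first by rewrite ler_wpM2r// ltW.
      by rewrite mul1r (le_trans (ler_norm _))// (le_trans (hM _ Sx))// ler_norm.
    have phiH c' x : 1 <= c' -> tail 1 x -> phi (tscale c' x) = phi x.
      move=> c'1 Tx; have c'0 : 0 < c' by exact: lt_le_trans c'1.
      by rewrite /phi /= normalize_tscale// gW_hom ?powRr0 ?mul1r//; exact: T10.
    have := tail_index_shift muP s1 mphi phi0M phiH.
    have iphi := integrable_homogeneous muP mphi phi0M.
    have qx x : tail 1 x -> Phi x = C * cq * h (normalize x).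
      by move=> Tx; rewrite /Phi qh ?mulrA//; exact/normalize_simplex/T10.
    have -> : I0 gj = C * cq * \int[mu]_(x in tail 1)
        (l1 x `^ (- (d%:R + (s - 1))) * phi x).
      rewrite -RintegralZl//; last 2 first.
      - exact: measurable_tail.
      - by apply: iphi; rewrite subr_gt0.
      apply: eq_Rintegral => x; rewrite inE => Tx.
      have lx : 0 < l1 x by case: (T10 x Tx).
      rewrite qx// /phi /gW /gj /Pw /=.
      rewrite (_ : - (d%:R + s) = - (d%:R + (s - 1)) + -1); last by ring.
      rewrite powRD; last by rewrite (gt_eqF lx) implybT.
      ring.
    have -> : I0 gW = C * cq * \int[mu]_(x in tail 1) (l1 x `^ (- (d%:R + s)) * phi x).
      rewrite -RintegralZl//; last 2 first.
      - exact: measurable_tail.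
      - exact: iphi.
      apply: eq_Rintegral => x; rewrite inE => Tx.
      rewrite qx// /phi /Pw /=; ring.
    by move=> hs; rewrite mulrCA hs mulrCA.
  have gn : gamma != 0 by rewrite gt_eqF.
  have gn1 : 1 - gamma != 0 by rewrite subr_eq0 gt_eqF.
  have an : I0 gone != 0 by rewrite gt_eqF.
  rewrite wbarE; apply: (@mulfI _ (s - 1)); first by rewrite gt_eqF// subr_gt0.
  rewrite b0J /s; field.
  by rewrite gn an gn1.
pose m := wbar j / (1 - gamma).
have m0 : m != 0.
  by apply/eqP => m0; move: b00; rewrite b0E -/m m0 mul0r ltxx.
rewrite b0E -/m in Ej.
have an : I0 gone != 0 by rewrite gt_eqF.
have := ratio_expansion rho0 an m0 E1 Ej; set L := (X in _ --> X) => ratlim.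
pose err u := cond_mean P (Xc j) [set w | u < Rs w] / (u * wbar j / (1 - gamma)) - 1.
have errlim : u `^ (- rho) * err u @[u --> +oo] --> L.
  apply: near_cvg_eq ratlim; near=> u.
  have u0 : 0 < u by near: u; apply: nbhs_pinfty_gt; exact: num_real.
  have us : u `^ s != 0 by rewrite gt_eqF// powR_gt0.
  have G1n : G gone u != 0.
    have : u `^ s * G gone u != 0 by near: u; exact: (cvgr_neq0 _ L1).
    by rewrite mulf_eq0 negb_or => /andP[].
  rewrite /err /cond_mean (numj _ (ltW u0)) (P1 _ (ltW u0)) -/(G gone u).
  rewrite -[u * wbar j / _]mulrA -/m.
  rewrite powRB ?(gt_eqF u0) ?implybT// powRr1 ?(ltW u0)//.
  congr (_ * (_ - 1)); field.
  by rewrite m0 G1n us gt_eqF.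
have L1' : x `^ s * surv P Rs x @[x --> +oo] --> I0 gone.
  apply: near_cvg_eq L1; near=> u.
  have u0 : 0 < u by near: u; apply: nbhs_pinfty_gt; exact: num_real.
  by rewrite survR// ltW.
have UR := quantile_pinfty mRs s0 a00 L1'.
have Uj := quantile_pinfty mXj s0 C0 LS.
have URs := quantile_powR_cvg mRs s0 a00 L1'.
have Ujs := quantile_powR_cvg mXj s0 C0 LS.
pose U1 := Ufun P Rs; pose U2 := Ufun P (Xc j).
(* [L] is the limit of the error at level [U1 t] divided by [U1 t ^ rho], the middle factor is the
   limit of [(U1 t / U2 t) ^ rho] obtained from the two quantile limits, and [c^-1] converts
   [U2 t ^ rho] into [A j (U2 t)]. *)
exists (c^-1 * (I0 gone / C) `^ (rho / s) * L).
have l1 : (U2 t `^ (- rho) * A j (U2 t))^-1 @[t --> +oo] --> c^-1.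
  by apply: cvgV => //; exact: (cvg_comp _ _ Uj Ac).
have l2 : ((U1 t `^ s / t) / (U2 t `^ s / t)) `^ (rho / s) @[t --> +oo]
    --> (I0 gone / C) `^ (rho / s).
  apply: powR_cvgy; first by rewrite divr_gt0.
  by apply: cvgyM => //; apply: cvgV => //; rewrite gt_eqF.
have l3 : U1 t `^ (- rho) * err (U1 t) @[t --> +oo] --> L.
  exact: (cvg_comp _ _ UR errlim).
have := cvgyM (cvgyM l1 l2) l3.
apply: near_cvg_eq; near=> t.
have t0 : 0 < t by near: t; apply: nbhs_pinfty_gt; exact: num_real.
have U1t : 1 <= U1 t by near: t; move/cvgryPge : UR; exact.
have U2t : 1 <= U2 t by near: t; move/cvgryPge : Uj; exact.
have U10 : 0 < U1 t by exact: lt_le_trans U1t.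
have U20 : 0 < U2 t by exact: lt_le_trans U2t.
rewrite /theta /Qfun opprB addrCA subrr addr0 invrK -/U1 -/U2 -/(err (U1 t)).
have -> : (U1 t `^ s / t / (U2 t `^ s / t)) `^ (rho / s) = U1 t `^ rho * U2 t `^ (- rho).
  have -> : U1 t `^ s / t / (U2 t `^ s / t) = U1 t `^ s * U2 t `^ (- s).
    rewrite powRN; field; rewrite !gt_eqF// powR_gt0//.
  rewrite powRM ?powR_ge0// -!powRrM mulNr [s * _]mulrC divfK// gt_eqF//.
rewrite !powRN invfM invrK.
have p1 : U1 t `^ rho != 0 by rewrite gt_eqF// powR_gt0.
have p2 : U2 t `^ rho != 0 by rewrite gt_eqF// powR_gt0.
move: (err _) ((A j (U2 t))^-1) => x y.
by field; rewrite p1 p2.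
Unshelve. all: end_near. Qed.
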